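(* (1) Let $p\in\{3,5,7\}$ and $G=D_{2p^2}$. The set of nonzero values of the group determinant $\mathscr{D}_G$ at integer arguments is exactly the set of integers of the form $2^ap^bm$ with $m\in\mathbb{Z}$, $\gcd(m,2p)=1$, $a,b$ nonnegative integers, $a=0$ or $a\ge 2$, and $b=0$ or $b\ge 5$. (2) Let $p$ be an odd prime, $k\ge 2$ an integer, and $G=D_{2p^k}$. Every nonzero value of $\mathscr{D}_G$ at integer arguments is of the form $2^ap^bm$ with $m\in\mathbb{Z}$, $\gcd(m,2p)=1$, $a,b$ nonnegative integers, $a=0$ or $a\ge 2$, and $b=0$ or $b\ge 2k+1$. Every integer of this form with $b=0$ or $b\ge 3k$ is a value of $\mathscr{D}_G$ at integer arguments. Moreover, there are values of $\mathscr{D}_G$ at integer arguments of this form with $b=2k+1$.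
   Context: For a finite group $G=\{g_1,\ldots,g_N\}$ and variables $x_g$ ($g\in G$), the group determinant is the $N\times N$ determinant $\mathscr{D}_G(x_{g_1},\ldots,x_{g_N})=\det\left(x_{g_ig_j^{-1}}\right)_{1\le i,j\le N}$; integer arguments means $(x_{g_1},\ldots,x_{g_N})\in\mathbb{Z}^N$. $D_{2n}=\langle R,F \mid R^n=1,\ F^2=1,\ RF=FR^{n-1}\rangle$ denotes the dihedral group of order $2n$. *)

(* Defs.v *)
From mathcomp Require Import all_boot all_order all_fingroup all_algebra all_solvable.

Set Implicit Arguments.
Unset Strict Implicit.
Unset Printing Implicit Defensive.

Import GRing.Theory.
Local Open Scope ring_scope.

(* The enumeration of gT is the one provided by its finType structure; since
   it indexes both rows and columns, the determinant does not depend on it. *)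
Definition group_det (R : comPzRingType) (gT : finGroupType) (x : gT -> R) : R :=
  \det (\matrix_(i < #|gT|, j < #|gT|) x (enum_val i * (enum_val j)^-1)%g).

Definition int_group_det_value (gT : finGroupType) (z : int) : Prop :=
  exists x : gT -> int, group_det x = z.

(* z = 2 ^ a * p ^ b * m with gcd(m, 2p) = 1 and a = 0 or a >= 2, where the
   exponent b is restricted by B. *)
Definition value_form (p : nat) (B : nat -> Prop) (z : int) : Prop :=
  exists (a b : nat) (m : int),
    [/\ coprimez m (2 * p)%N,
        a = 0%N \/ (2 <= a)%N,
        B b &
        z = 2%:Z ^+ a * p%:Z ^+ b * m].

(* Main.v *)
Require Import Defs.
From mathcomp Require Import all_boot all_order all_fingroup all_algebra all_solvable.
From mathcomp Require Import all_field.
From mathcomp Require Import ring zify.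

(** Let n be odd, w a primitive n-th root of unity and R, F the generators of
    the dihedral group of order 2n. Listing the group as R^i, then R^-j F,
    turns the matrix of the group determinant into four commuting circulant
    blocks, and the Fourier basis gives the value as the product over the n-th
    roots of unity x of N(x) = f(x) f(1/x) - g(x) g(1/x), where f and g are
    integer polynomials that can be prescribed freely ([dihedral_value_norm],
    [dihedral_norm_value]). Write chi(x) = (1 - x)(1 - 1/x). The product of chi
    over the roots x other than 1 is n^2.

    Restrictions. Listing the group as R^i, then R^j F, gives instead the blocks
    A, B, B, A, so that the value is det (A + B) det (A - B); these factors agree
    modulo 2, and an even value is a multiple of 4. For n = p^k, N(x) is the
    integer c = N(1) plus an integral multiple of chi(x), and p is an integral
    multiple of chi(x) as soon as x is not 1. If p divides c, then every factor
    N(x) with x not 1 is an integral multiple of chi(x), and the value is a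
    multiple of c n^2, hence of p^(2k+1). If p does not divide c, then neither
    does it divide the value, which is c^n modulo 1 - w.

    Values. They are closed under products, so it is enough to produce -1,
    the positive integers coprime to 2n, the powers 2^a with a at least 2, and powers of
    p. The polynomials f = 1 + x + ... + x^(s-1) and g = 1 + x + ... + x^(t-1)
    give N(x) = x^(1-s) [s+t] [s-t], where [a] = 1 + x + ... + x^(a-1) is a unit
    with product 1 when a is coprime to n; the value is then (s + t)(s - t)
    ([value_diff_squares]). Next, the choice f = 1 - g gives
    N(x) = 1 - g(x) - g(1/x), so the product over the roots of unity of any
    integer Laurent polynomial invariant under x -> 1/x and odd at 1 is a value
    ([pal_value]). Taking chi(x) + t (1 + x + ... + x^(n-1)) with t a power
    of p yields p^b for b at least 3k; taking p - 2 chi(x) yields exponent exactly 2k + 1.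

    The exponent 5 for p = 3, 5, 7 and k = 2 needs a palindromic H with
    H(1) = p and H(x) = chi(x) times a unit of norm 1 at all other roots. The unit
    has to differ at the roots of order p and p^2: if a single Laurent polynomial
    U gave it at both, H - chi U would be a multiple of 1 + x + ... + x^(p^2-1),
    and p^2 would divide H(1). With S = 1 + x + 1/x + ... the palindromic
    p-th cyclotomic polynomial, take H = chi U + A S(x^p). It is chi U at the
    roots of order p^2, and A is chosen with A(1) = 1 and chi U + p A = chi V at
    the roots of order p. Leaving A(1) aside, this is possible when U and V are
    congruent modulo p and chi^((p-3)/2), because S is plus or minus a power of
    chi modulo p. The units used are products of -1, 1 - chi, 2 - chi and
    3 - chi, that is, up to a power of x, of cyclotomic polynomials of index 6, 4
    and 3. *)

Set Implicit Arguments.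
Unset Strict Implicit.
Unset Printing Implicit Defensive.

Import Order.TTheory GRing.Theory Num.Theory.
Import Pdiv.CommonRing Pdiv.RingMonic.
Local Open Scope ring_scope.

(** * Determinants of groups, blocks and circulants *)

Lemma det_reindex (R : comPzRingType) (T : finType) (m : nat) (e : 'I_m -> T)
    (M : T -> T -> R) : bijective e ->
  \det (\matrix_(i < #|T|, j < #|T|) M (enum_val i) (enum_val j)) =
  \det (\matrix_(i < m, j < m) M (e i) (e j)).
Proof.
move=> bij_e; have Em : m = #|T| by rewrite -(bij_eq_card bij_e) card_ord.
subst m; have inj_s : injective (fun i => enum_rank (e i)).
  exact: (inj_comp enum_rank_inj (bij_inj bij_e)).
set A := \matrix_(i, j) M (enum_val i) _.
have -> : \matrix_(i, j) M (e i) (e j) =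
          row_perm (perm inj_s) (col_perm (perm inj_s) A).
  by apply/matrixP=> i j; rewrite !mxE !permE !enum_rankK.
rewrite row_permE col_permE !det_mulmx !det_perm odd_permV mulrCA.
by rewrite -signr_addb addbb mulr1.
Qed.

(** The matrix of the convolution of x and y is the product of their matrices:
    the determinant is multiplicative on the group ring. *)
Lemma group_det_conv (R : comPzRingType) (gT : finGroupType) (x y : gT -> R) :
  group_det (fun g => \sum_h x (g * h^-1)%g * y h) = group_det x * group_det y.
Proof.
rewrite /group_det -det_mulmx; congr (\det _); apply/matrixP=> i j.
rewrite !mxE (reindex_inj (mulIg (enum_val j)^-1%g)) /=.
rewrite (reindex_onto (@enum_val gT predT) enum_rank) /=; last first.
  by move=> g _; rewrite enum_rankK.
rewrite (eq_bigl xpredT) => [|k]; last by rewrite enum_valK eqxx.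
by apply: eq_bigr => k _; rewrite !mxE invMg invgK mulgA mulgKV.
Qed.

Lemma int_group_det_valueM (gT : finGroupType) (y z : int) :
  int_group_det_value gT y -> int_group_det_value gT z ->
  int_group_det_value gT (y * z).
Proof.
by move=> [u <-] [v <-]; eexists; apply: group_det_conv.
Qed.

(** Right multiplication by the lower triangular block matrix with blocks D, 0,
    -C, 1 proves the formula multiplied by det D. To be able to cancel, D is
    replaced by D + X over the polynomial ring: det (D + X) is monic, hence
    regular. Setting X = 0 gives the claim. *)
Lemma det_block_comm (R : comNzRingType) (n : nat) (A B C D : 'M[R]_n) :
  C *m D = D *m C -> \det (block_mx A B C D) = \det (A *m D - B *m C).
Proof.
move=> comCD; pose P (M : 'M[R]_n) := map_mx polyC M.
pose Dx := P D + 'X%:M.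
have comP : P C *m Dx = Dx *m P C.
  by rewrite mulmxDr mulmxDl -!map_mxM comCD scalar_mxC.
have regDx : GRing.rreg (\det Dx).
  apply: monic_rreg; have -> : Dx = char_poly_mx (- D).
    by rewrite /char_poly_mx map_mxN opprK addrC.
  exact: char_poly_monic.
have eq_x : \det (block_mx (P A) (P B) (P C) Dx) =
            \det (P A *m Dx - P B *m P C).
  apply: regDx; rewrite -[LHS]/(_ * _).
  have <- : \det (block_mx Dx 0 (- P C) 1%:M) = \det Dx.
    by rewrite det_lblock det1 mulr1.
  rewrite -det_mulmx mulmx_block !mulmx0 !mulmx1 !add0r !mulmxN comP addrN.
  by rewrite det_ublock -[RHS]/(_ * _) det_lblock det1 mulr1.
have ev0 (m : nat) (M : 'M[{poly R}]_m) :
    (\det M).[0] = \det (map_mx (horner_eval 0) M).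
  by rewrite -horner_evalE det_map_mx.
have PK (M : 'M[R]_n) : map_mx (horner_eval 0) (P M) = M.
  by apply/matrixP=> i j; rewrite !mxE horner_evalE hornerC.
have DK : map_mx (horner_eval 0) Dx = D.
  by rewrite map_mxD PK map_scalar_mx /= horner_evalE hornerX raddf0 addr0.
have := congr1 (fun q => q.[0]) eq_x.
by rewrite !ev0 map_block_mx map_mxB !map_mxM !PK DK.
Qed.

(** A row and a column operation triangularize the block matrix. *)
Lemma det_block_swap (R : comNzRingType) (n : nat) (A B : 'M[R]_n) :
  \det (block_mx A B B A) = \det (A + B) * \det (A - B).
Proof.
have := det_mulmx (block_mx 1%:M 1%:M 0 1%:M) (block_mx A B B A).
rewrite det_ublock !det1 mulr1 mul1r => <-.
have := det_mulmx (block_mx 1%:M 1%:M 0 1%:M *m block_mx A B B A)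
                  (block_mx 1%:M (- 1%:M) 0 1%:M).
rewrite det_ublock !det1 !mulr1 => <-.
rewrite !mulmx_block !mul1mx !mul0mx !mulmx0 !add0r !addr0 !mulmxN !mulmx1.
by rewrite [B + A]addrC addNr det_lblock [- B + A]addrC.
Qed.

Section Circulant.

Variables (R : comPzRingType) (n : nat).
Implicit Types c : 'I_n.+1 -> R.

(** Indices are subtracted in the cyclic group of integers modulo n + 1. *)
Definition circulant c : 'M[R]_n.+1 := \matrix_(i, j) c (i - j).

Lemma circulant_comm a b :
  circulant a *m circulant b = circulant b *m circulant a.
Proof.
apply/matrixP=> i j; rewrite !mxE.
rewrite (reindex_inj (subrI (i + j))) /=; apply: eq_bigr => k _.
rewrite !mxE mulrC; congr (_ * _); [congr b | congr a].
  by rewrite addrAC addrK.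
by rewrite opprB addrCA opprD addNKr.
Qed.

Lemma circulant_tr c : (circulant c)^T = circulant (c \o -%R).
Proof. by apply/matrixP=> i j; rewrite !mxE /= opprB. Qed.

End Circulant.

Section CirculantSpectrum.

Variables (F : fieldType) (n : nat) (w : F).
Hypothesis prim_w : n.+1.-primitive_root w.

Definition fourier : 'M[F]_n.+1 := Vandermonde n.+1 (\row_l w ^+ l).

Lemma det_fourier_neq0 : \det fourier != 0.
Proof.
rewrite det_Vandermonde; apply/prodf_neq0=> i _; apply/prodf_neq0=> j lt_ij.
rewrite !mxE subr_eq0 (eq_prim_root_expr prim_w) !modn_small ?ltn_ord //.
by rewrite gtn_eqF.
Qed.

Lemma expr_ord_sub (z : F) (i j : 'I_n.+1) : z ^+ n.+1 = 1 ->
  z ^+ (i - j)%R = z ^+ i * z^-1 ^+ j.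
Proof.
move=> zn1; have z0 : z != 0.
  by apply/eqP=> z0; move/eqP: zn1; rewrite z0 expr0n eq_sym oner_eq0.
rewrite /= (expr_mod _ zn1) exprD (expr_mod _ zn1) exprVn; congr (_ * _).
apply: (mulIf (expf_neq0 j z0)); rewrite mulVf ?expf_neq0 // -exprD subnK //.
exact: ltnW.
Qed.

(** The characters of the cyclic group are eigenvectors of every circulant. *)
Lemma circulant_fourier (c : 'I_n.+1 -> F) :
  circulant c *m fourier =
  fourier *m diag_mx (\row_l \sum_m c m * (w ^+ l)^-1 ^+ m).
Proof.
apply/matrixP=> i l; rewrite mul_mx_diag !mxE mulr_sumr (reindex_inj (subrI i)).
apply: eq_bigr => m _ /=; rewrite !mxE opprB addrC subrK mulrCA; congr (_ * _).
by rewrite -expr_ord_sub // exprAC (prim_expr_order prim_w) expr1n.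
Qed.

Lemma circulant_tr_fourier (c : 'I_n.+1 -> F) :
  (circulant c)^T *m fourier =
  fourier *m diag_mx (\row_l \sum_m c m * (w ^+ l) ^+ m).
Proof.
rewrite circulant_tr circulant_fourier; congr (_ *m diag_mx _).
apply/rowP=> l; rewrite !mxE (reindex_inj oppr_inj); apply: eq_bigr => m _.
rewrite /comp opprK -(sub0r m).
rewrite expr_ord_sub ?mul1r ?invrK //.
by rewrite exprVn exprAC (prim_expr_order prim_w) expr1n invr1.
Qed.

Lemma det_circulants (a b : 'I_n.+1 -> F) (f g : F -> F) :
    (forall y, f y = \sum_m a m * y ^+ m) ->
    (forall y, g y = \sum_m b m * y ^+ m) ->
  \det (circulant a *m (circulant a)^T - circulant b *m (circulant b)^T) =
  \prod_(i < n.+1) (f (w ^+ i) * f (w ^+ i)^-1 - g (w ^+ i) * g (w ^+ i)^-1).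
Proof.
move=> fE gE; apply: (mulIf det_fourier_neq0); rewrite -det_mulmx mulmxBl.
rewrite -!mulmxA !circulant_tr_fourier !mulmxA !circulant_fourier -!mulmxA.
rewrite -mulmxBr !mulmx_diag -raddfB det_mulmx det_diag mulrC; congr (_ * _).
by apply: eq_bigr => i _; rewrite !mxE !fE !gE; congr (_ - _); apply: mulrC.
Qed.

End CirculantSpectrum.

(** * The dihedral determinant as a product over roots of unity *)

(** The map is onto because the two cyclic subgroups multiply to the whole
    group; comparing cardinals, it is one-to-one, so R and F have exact orders q
    and 2. *)
Lemma dihedral_pres_bij (gT : finGroupType) (q : nat) (r s : gT) :
    (<[r]> * <[s]>)%g = [set: gT] ->
    (0 < q)%N -> (r ^+ q = 1)%g -> (s ^+ 2 = 1)%g -> #|gT| = q.*2 ->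
  bijective (fun ib : 'I_q * bool => r ^+ ib.1 * s ^+ ib.2)%g.
Proof.
move=> defG q_gt0 rq s2 oG.
set e := fun ib : 'I_q * bool => _.
have onto g : g \in codom e.
  have : g \in (<[r]> * <[s]>)%g by rewrite defG inE.
  case/mulsgP=> _ _ /cycleP[i ->] /cycleP[j ->] ->.
  apply/codomP; exists (Ordinal (ltn_pmod i q_gt0), odd j); rewrite /e /=.
  by rewrite -modn2 !expg_mod.
have cardE : #|{: 'I_q * bool}| = #|gT|.
  by rewrite card_prod card_ord card_bool muln2 oG.
apply: inj_card_bij; last by rewrite cardE.
have cardI : #|codom e| == #|{: 'I_q * bool}|.
  by rewrite cardE; apply/eqP/eq_card=> g; rewrite onto inE.
move=> x y exy; move/image_injP: cardI => inj_e; exact: inj_e exy.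
Qed.

Lemma dihedral_enum (q : nat) : (1 < q)%N ->
  exists r s : 'D_(2 * q),
    [/\ r ^+ q = 1, s ^+ 2 = 1, r ^ s = r^-1 &
        bijective (fun ib : 'I_q * bool => r ^+ ib.1 * s ^+ ib.2)]%g.
Proof.
move=> q_gt1; rewrite mul2n; have := isog_refl [set: 'D_(q.*2)].
case/(isoGrpP _ (Grp_dihedral q_gt1)).
move=> _ /existsP[[r s]] /= /eqP[defG rq s2 rs].
have{} defG : (<[r]> * <[s]>)%g = [set: 'D_(q.*2)].
  by rewrite -norm_joinEr // norms_cycle rs groupV cycle_id.
have oG : #|{: 'D_(q.*2)}| = q.*2 by rewrite -cardsT card_dihedral.
exists r, s; split=> //.
exact: dihedral_pres_bij defG (ltnW q_gt1) rq s2 oG.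
Qed.

Lemma expg_ord_sub (gT : finGroupType) (n : nat) (r : gT) (i j : 'I_n.+1) :
  (r ^+ n.+1 = 1)%g -> (r ^+ (i - j)%R = r ^+ i * (r ^+ j)^-1)%g.
Proof.
move=> rn1; rewrite /= (expg_mod _ rn1) expgD (expg_mod _ rn1); congr (_ * _)%g.
by apply: (mulIg (r ^+ j)%g); rewrite mulVg -expgD subnK // ltnW.
Qed.

(** The reindexing u of the reflections is a parameter because two choices are
    needed: u = -%R makes all four blocks circulant, whereas u = id puts the same
    block twice on the diagonal and twice off it. *)
Lemma group_det_dihedral_block (R : comPzRingType) (gT : finGroupType) (n : nat)
    (r s : gT) (u : 'I_n.+1 -> 'I_n.+1) (x : gT -> R)
    (a := fun i : 'I_n.+1 => x (r ^+ i)%g)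
    (b := fun i : 'I_n.+1 => x (r ^+ i * s)%g) :
    [/\ r ^+ n.+1 = 1, s ^+ 2 = 1, r ^ s = r^-1 &
        bijective (fun ib : 'I_n.+1 * bool => r ^+ ib.1 * s ^+ ib.2)]%g ->
    injective u ->
  group_det x = \det (block_mx (\matrix_(i, j) a (i - j))
                               (\matrix_(i, j) b (i + u j))
                               (\matrix_(i, j) b (u i + j))
                               (\matrix_(i, j) a (u i - u j))).
Proof.
move=> [rn s2 rs bij_e] inj_u.
pose phi (k : 'I_(n.+1 + n.+1)) :=
  match split k with inl i => (i, false) | inr j => (u j, true) end.
pose e k := (r ^+ (phi k).1 * s ^+ (phi k).2)%g.
have inj_phi : injective phi.
  move=> k l; rewrite -[k]splitK -[l]splitK /phi !unsplitK.
  by case: (split k) (split l) => i [] j [] // => [|/inj_u] ->.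
have bij_phi : bijective phi.
  by apply: inj_card_bij => //; rewrite card_prod card_bool !card_ord addnn muln2.
have sV : (s^-1 = s)%g by apply/eqP; rewrite eq_invg_mul -s2 expgS expg1.
have sr i : (s * (r ^+ i)^-1 = r ^+ i * s)%g.
  have -> : (r ^+ i)^-1%g = ((r ^+ i) ^ s)%g by rewrite conjXg rs expgVn.
  by rewrite conjgE sV !mulgA -expg2 s2 mul1g.
rewrite /group_det.
rewrite (det_reindex (fun g h => x (g * h^-1)%g) (bij_comp bij_e bij_phi)).
congr (\det _); apply/matrixP=> k l.
rewrite -[k]splitK -[l]splitK /=; case: (split k) (split l) => i [] j /=.
- rewrite block_mxEul !mxE /phi -!/(unsplit (inl _)) !unsplitK /= !mulg1.
  by rewrite -expg_ord_sub.
- rewrite block_mxEur !mxE /phi -[lshift _ _]/(unsplit (inl _)).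
  rewrite -[rshift _ _]/(unsplit (inr _)) !unsplitK /= mulg1 expg1.
  rewrite invMg sV sr mulgA -expgD /b; congr (x (_ * _)%g).
  by rewrite /= (expg_mod _ rn).
- rewrite block_mxEdl !mxE /phi -[lshift _ _]/(unsplit (inl _)).
  rewrite -[rshift _ _]/(unsplit (inr _)) !unsplitK /= mulg1 expg1.
  rewrite -mulgA sr mulgA -expgD /b; congr (x (_ * _)%g).
  by rewrite /= (expg_mod _ rn).
rewrite block_mxEdr !mxE /phi -!/(unsplit (inr _)) !unsplitK /= !expg1.
by rewrite invMg sV -mulgA (mulgA s) -expg2 s2 mul1g -expg_ord_sub.
Qed.

Definition ev (f : {poly int}) (y : algC) : algC := (map_poly intr f).[y].

(** This is the determinant of f + gF in the two-dimensional representation of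
    the dihedral group in which R has the eigenvalues y and 1/y. *)
Definition dihedral_norm (f g : {poly int}) (y : algC) : algC :=
  ev f y * ev f y^-1 - ev g y * ev g y^-1.

Section Dihedral.

Variables (q : nat) (w : algC).
Hypotheses (q_gt1 : (1 < q)%N) (prim_w : q.-primitive_root w).

Lemma det_dihedral (r s : 'D_(2 * q)) (x : 'D_(2 * q) -> int) (f g : {poly int}) :
    [/\ r ^+ q = 1, s ^+ 2 = 1, r ^ s = r^-1 &
        bijective (fun ib : 'I_q * bool => r ^+ ib.1 * s ^+ ib.2)]%g ->
    f = \poly_(i < q) x (r ^+ i)%g -> g = \poly_(i < q) x (r ^+ i * s)%g ->
  (group_det x)%:~R = \prod_(i < q) dihedral_norm f g (w ^+ i).
Proof.
move: w prim_w r s x q_gt1; case: q => [//|n] z prim_z r s x n_gt0 pres Ef Eg.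
rewrite (group_det_dihedral_block x pres (@oppr_inj _)).
pose a (i : 'I_n.+1) := x (r ^+ i)%g; pose b (i : 'I_n.+1) := x (r ^+ i * s)%g.
have -> : block_mx (\matrix_(i, j) a (i - j)) (\matrix_(i, j) b (i + - j))
                   (\matrix_(i, j) b (- i + j)) (\matrix_(i, j) a (- i - - j))
     = block_mx (circulant a) (circulant b) (circulant b)^T (circulant a)^T.
  congr block_mx; apply/matrixP=> i j; rewrite !mxE //.
    by rewrite addrC.
  by rewrite opprK addrC.
rewrite det_block_comm; last by rewrite !circulant_tr circulant_comm.
rewrite -(@det_map_mx _ _ intr) map_mxB !map_mxM -!map_trmx.
have mapC (c : 'I_n.+1 -> int) :
    map_mx intr (circulant c) = circulant (fun i => (c i)%:~R : algC).
  by apply/matrixP=> i j; rewrite !mxE.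
have evE (c : nat -> int) y :
    ev (\poly_(i < n.+1) c i) y = \sum_(m < n.+1) (c m)%:~R * y ^+ m.
  rewrite /ev (@horner_coef_wide _ n.+1); last first.
    by rewrite (leq_trans (size_poly _ _)) // size_poly.
  by apply: eq_bigr => m _; rewrite coef_map coef_poly ltn_ord.
rewrite !mapC (det_circulants prim_z (f := ev f) (g := ev g)) // => y.
  by rewrite Ef evE.
by rewrite Eg evE.
Qed.

Lemma dihedral_value_norm (z : int) : int_group_det_value 'D_(2 * q) z ->
  exists f g, z%:~R = \prod_(i < q) dihedral_norm f g (w ^+ i).
Proof.
move=> [x <-]; have [r [s pres]] := dihedral_enum q_gt1.
by do 2!eexists; apply: det_dihedral pres _ _.
Qed.

(** Reduction modulo X^q - 1 is what allows f and g to have any degree. *)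
Lemma ev_modXn1 (f : {poly int}) (y : algC) : y ^+ q = 1 ->
  ev (rmodp f ('X^q - 1)) y = ev f y.
Proof.
move=> yq; rewrite {2}(rdivp_eq (monic_Xn_sub_1 _ (ltnW q_gt1)) f).
rewrite /ev rmorphD rmorphM rmorphB /= map_polyXn rmorph1 hornerD hornerM.
by rewrite hornerD hornerN hornerXn hornerC yq subrr mulr0 add0r.
Qed.

Lemma dihedral_norm_value (f g : {poly int}) :
  exists2 z, int_group_det_value 'D_(2 * q) z &
    z%:~R = \prod_(i < q) dihedral_norm f g (w ^+ i).
Proof.
have [r [s pres]] := dihedral_enum q_gt1; have [_ _ _ [e' eK e'K]] := pres.
(* The group element R^i F^b receives the i-th coefficient of f or g, reduced
   modulo X^q - 1. *)
pose f' := rmodp f ('X^q - 1); pose g' := rmodp g ('X^q - 1).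
pose x h := let: (i, b) := e' h in if b then g'`_i else f'`_i.
have szXn : size ('X^q - 1 : {poly int}) = q.+1 by rewrite size_Xn_sub_1 // ltnW.
have polyE (p : {poly int}) (c : nat -> int) :
    (forall i : 'I_q, c i = (rmodp p ('X^q - 1))`_i) ->
  rmodp p ('X^q - 1) = \poly_(i < q) c i.
  move=> Ec; apply/polyP=> i; rewrite coef_poly; case: ltnP => [lt_iq | le_qi].
    by rewrite (Ec (Ordinal lt_iq)).
  apply: nth_default; apply: leq_trans le_qi.
  by rewrite -ltnS -szXn ltn_rmodp -size_poly_eq0 szXn.
exists (group_det x); first by exists x.
rewrite (@det_dihedral r s x f' g') //.
- apply: eq_bigr => i _; rewrite /dihedral_norm !ev_modXn1 //.
  + by rewrite exprVn exprAC (prim_expr_order prim_w) expr1n invr1.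
  + by rewrite exprAC (prim_expr_order prim_w) expr1n.
  + by rewrite exprVn exprAC (prim_expr_order prim_w) expr1n invr1.
  by rewrite exprAC (prim_expr_order prim_w) expr1n.
- apply: polyE => i; rewrite /x.
  by have /= := eK (i, false); rewrite mulg1 => ->.
apply: polyE => i; rewrite /x.
by have /= := eK (i, true); rewrite expg1 => ->.
Qed.

(** The value is det (A + B) det (A - B), and the two factors have the same
    parity. *)
Lemma dihedral_value_even (z : int) : int_group_det_value 'D_(2 * q) z ->
  (2 %| z)%Z -> (4 %| z)%Z.
Proof.
move=> [x <-]; have [r [s pres]] := dihedral_enum q_gt1.
move: r s x pres q_gt1; case: q => [//|n] r s x pres _.
rewrite (group_det_dihedral_block x pres (u := id)) // det_block_swap.
set A := \matrix_(i, j) _; set B := \matrix_(i, j) _.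
have ch2 : 2 \in [pchar 'F_2] by apply: pchar_Fp.
have eq_mod2 : (\det (A + B))%:~R = (\det (A - B))%:~R :> 'F_2.
  rewrite -!(@det_map_mx _ _ intr) map_mxD map_mxB; congr (\det (_ + _)).
  by apply/matrixP=> i j; rewrite !mxE oppr_pchar2.
rewrite (dvdz_pcharf ch2) rmorphM /= eq_mod2 mulf_eq0 orbb => even_det.
by apply: (@dvdz_mul 2 2); rewrite (dvdz_pcharf ch2) ?eq_mod2.
Qed.

End Dihedral.

(** * Products over the nontrivial n-th roots of unity *)

Lemma expr1_neq0 (n : nat) (x : algC) : (0 < n)%N -> x ^+ n = 1 -> x != 0.
Proof.
move=> n_gt0 xn; apply/eqP=> x0; move/eqP: xn.
by rewrite x0 expr0n gtn_eqF // eq_sym oner_eq0.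
Qed.

(** On the unit circle this is the square of the distance from x to 1. *)
Definition sqchord (x : algC) : algC := (1 - x) * (1 - x^-1).

Section RootProducts.

Variables (n : nat) (w : algC).
Hypothesis prim_w : n.-primitive_root w.

Let n_gt0 : (0 < n)%N := prim_order_gt0 prim_w.

Lemma prim_pow1 i : (w ^+ i) ^+ n = 1.
Proof. by rewrite exprAC (prim_expr_order prim_w) expr1n. Qed.

Lemma prim_pow_neq1 i : (1 <= i < n)%N -> w ^+ i != 1.
Proof.
case/andP=> i_gt0 lt_in; rewrite -(expr0 w) (eq_prim_root_expr prim_w).
by rewrite mod0n modn_small // -lt0n.
Qed.

Lemma prod_roots_split (F : algC -> algC) :
  \prod_(i < n) F (w ^+ i) = F 1 * \prod_(1 <= i < n) F (w ^+ i).
Proof. by rewrite -(big_mkord xpredT (fun i => F (w ^+ i))) big_ltn // expr0. Qed.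

Lemma eq_nontriv_prod (F G : algC -> algC) :
    (forall x, x ^+ n = 1 -> x != 1 -> F x = G x) ->
  \prod_(1 <= i < n) F (w ^+ i) = \prod_(1 <= i < n) G (w ^+ i).
Proof.
move=> eqFG; rewrite !big_nat; apply: eq_bigr => i lt_i.
by apply: eqFG; [apply: prim_pow1 | apply: prim_pow_neq1].
Qed.

(** Raising to a power coprime to n permutes the n-th roots of unity and fixes 1. *)
Lemma nontriv_prod_pow (a : nat) (F : algC -> algC) : coprime n a ->
  \prod_(1 <= i < n) F ((w ^+ i) ^+ a) = \prod_(1 <= i < n) F (w ^+ i).
Proof.
(* Redefining F to be 1 at 1 turns these products into products over all
   roots, where the reindexing is a bijection. *)
move=> co_na; pose F' y := if y == 1 then 1 else F y.
have F'E i : (1 <= i < n)%N -> F (w ^+ i) = F' (w ^+ i).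
  by move=> /prim_pow_neq1/negPf ne1; rewrite /F' ne1.
have F'aE i : (1 <= i < n)%N -> F ((w ^+ i) ^+ a) = F' ((w ^+ i) ^+ a).
  move=> lt_in; rewrite /F' ifN // -exprM -(expr0 w) (eq_prim_root_expr prim_w).
  rewrite mod0n -/(n %| i * a)%N Gauss_dvdl //; case/andP: lt_in => i0 lt_in.
  by rewrite gtnNdvd.
rewrite big_nat (eq_bigr _ F'aE) -big_nat [RHS]big_nat (eq_bigr _ F'E) -big_nat.
have F'1 : F' 1 = 1 by rewrite /F' eqxx.
have := prod_roots_split F'; rewrite F'1 mul1r => <-.
have := prod_roots_split (fun y => F' (y ^+ a)); rewrite expr1n F'1 mul1r => <-.
pose s (i : 'I_n) := Ordinal (ltn_pmod (i * a) n_gt0).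
have prim_wa : n.-primitive_root (w ^+ a).
  by rewrite (prim_root_exp_coprime _ prim_w) coprime_sym.
have inj_s : injective s.
  move=> i j /(congr1 val)/= /eqP; rewrite -(eq_prim_root_expr prim_w).
  rewrite !(mulnC _ a) !exprM (eq_prim_root_expr prim_wa) !modn_small // => /eqP.
  exact: val_inj.
rewrite [RHS](reindex_inj inj_s); apply: eq_bigr => i _ /=.
by rewrite -exprM (prim_expr_mod prim_w).
Qed.

Lemma nontriv_prod_1sub : \prod_(1 <= i < n) (1 - w ^+ i) = n%:R.
Proof.
have := factor_Xn_sub_1 prim_w; rewrite big_ltn // expr0 subrX1.
move/(mulfI (negbT (polyXsubC_eq0 1)))/(congr1 (fun p => p.[1])).
rewrite horner_prod horner_sum => eq1.
transitivity (\prod_(1 <= i < n) ('X - (w ^+ i)%:P).[1]).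
  by apply: eq_bigr => i _; rewrite hornerXsubC.
rewrite eq1 -[n in RHS]card_ord -sumr_const; apply: eq_bigr => i _.
by rewrite hornerXn expr1n.
Qed.

Lemma nontriv_prod_inv (F : algC -> algC) :
  \prod_(1 <= i < n) F (w ^+ i)^-1 = \prod_(1 <= i < n) F (w ^+ i).
Proof.
rewrite -[RHS](@nontriv_prod_pow n.-1); last by rewrite coprime_sym coprimePn.
apply: eq_bigr => i _; congr (F _); apply: (mulfI (expr1_neq0 n_gt0 (prim_pow1 i))).
by rewrite divff ?(expr1_neq0 n_gt0) ?prim_pow1 // -exprS prednK // prim_pow1.
Qed.

Lemma nontriv_prod_sqchord : \prod_(1 <= i < n) sqchord (w ^+ i) = n%:R ^+ 2.
Proof.
rewrite big_split /= nontriv_prod_1sub.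
by rewrite (nontriv_prod_inv (fun x => 1 - x)) nontriv_prod_1sub.
Qed.

(** Inversion permutes the factors, so the product is its own inverse; it is
    also an n-th root of unity, and n is odd. *)
Lemma nontriv_prod_id : odd n -> \prod_(1 <= i < n) w ^+ i = 1.
Proof.
move=> odd_n; set T := \prod_(1 <= i < n) _.
have TV : T^-1 = T by rewrite /T -prodfV (nontriv_prod_inv (fun x => x)).
have Tn : T ^+ n = 1.
  by rewrite /T -prodrXl big1 // => i _; apply: prim_pow1.
have T2 : T ^+ 2 = 1.
  by rewrite expr2 -{1}TV mulVf // (expr1_neq0 n_gt0 Tn).
by rewrite -Tn -(odd_double_half n) odd_n exprD -muln2 mulnC exprM T2 expr1n mulr1.
Qed.

(** This is the quotient of the products of x^a - 1 and of x - 1, which agree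
    because a is coprime to n. *)
Lemma nontriv_prod_quantum (a : nat) : coprime n a ->
  \prod_(1 <= i < n) (\sum_(j < a) (w ^+ i) ^+ j) = 1.
Proof.
move=> co_na; have nz : \prod_(1 <= i < n) (w ^+ i - 1) != 0.
  rewrite prodf_seq_neq0; apply/allP=> i; rewrite mem_index_iota => lt_in.
  by rewrite subr_eq0 prim_pow_neq1.
apply: (mulfI nz); rewrite mulr1 -big_split /=.
rewrite -[RHS](nontriv_prod_pow (fun x => x - 1) co_na).
by apply: eq_bigr => i _; rewrite -subrX1.
Qed.

End RootProducts.

(** * The prime p in the ring of algebraic integers *)

Lemma prod_multiples (R : comPzRingType) (p m : nat) (G : nat -> R) : (0 < p)%N ->
  \prod_(1 <= i < p * m | (p %| i)%N) G i = \prod_(1 <= i < m) G (p * i)%N.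
Proof.
move=> p_gt0; elim: m => [|[|m] IHm].
- by rewrite muln0 !big_geq.
- rewrite muln1 [RHS]big_geq // big_nat_cond big_pred0 // => i.
  by apply/andP=> -[/andP[i0 lt_ip]]; rewrite gtnNdvd.
rewrite [RHS]big_nat_recr //= -IHm.
rewrite (@big_cat_nat _ _ _ (p * m.+1)) //=; last 2 first.
- by rewrite muln_gt0 p_gt0.
- by rewrite leq_mul2l leqnSn orbT.
congr (_ * _); rewrite big_ltn_cond; last by rewrite ltn_pmul2l.
rewrite dvdn_mulr // big_nat_cond big_pred0 ?mulr1 // => i.
apply/negP=> /andP[/andP[lt1 lt2] /dvdnP[j def_i]].
move: lt1 lt2; rewrite def_i (mulnC j) (ltn_pmul2l p_gt0) (ltn_pmul2l p_gt0) => lt1.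
by rewrite ltnS leqNgt lt1.
Qed.

Lemma dvdA_mulr (e z : algC) : z \in Aint -> (e %| e * z)%A.
Proof. by move=> Az; rewrite -eqAmod0 eqAmodMr0. Qed.

Lemma dvdAP (e z : algC) : (e %| z)%A -> exists2 t, t \in Aint & z = e * t.
Proof.
rewrite unfold_in; case: ifP => [_ /eqP-> | /negbT e0 Az].
  by exists 0; rewrite ?Aint0 ?mulr0.
by exists (z / e) => //; rewrite mulrC divfK.
Qed.

Lemma Aint_root1 (n : nat) (x : algC) : (0 < n)%N -> x ^+ n = 1 -> x \in Aint.
Proof. by move=> n_gt0 xn; apply: (Aint_unity_root n_gt0); apply/unity_rootP. Qed.

Lemma Aint_root1V (n : nat) (x : algC) : (0 < n)%N -> x ^+ n = 1 -> x^-1 \in Aint.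
Proof. by move=> n_gt0 xn; apply: (Aint_root1 n_gt0); rewrite exprVn xn invr1. Qed.

Lemma dvdA_1sub_exp (x : algC) i : x \in Aint ->
  exists2 t, t \in Aint & 1 - x ^+ i = (1 - x) * t.
Proof.
move=> Ax; exists (\sum_(j < i) x ^+ j).
  by rewrite rpred_sum // => j _; rewrite rpredX.
by rewrite -[LHS]opprB subrX1 -mulNr opprB.
Qed.

(** A rational algebraic integer is an integer. *)
Lemma Aint_int_quotient (c d : int) (t : algC) : d != 0 -> t \in Aint ->
  c%:~R = d%:~R * t -> exists2 m, t = m%:~R & c = d * m.
Proof.
move=> d0 At Ec; have dC0 : d%:~R != 0 :> algC by rewrite intr_eq0.
have /intrP[m Em] : t \is a Num.int.
  apply: Cint_rat_Aint => //; have -> : t = c%:~R / d%:~R.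
    by rewrite Ec mulrC mulKf.
  by rewrite rpred_div ?rpred_int.
exists m => //; apply: (@intr_inj algC).
by rewrite Ec Em rmorphM.
Qed.

Lemma eqAmod_prod (I : Type) (r : seq I) (P : pred I) (e : algC) (F G : I -> algC) :
  (forall i, P i -> [/\ F i \in Aint, G i \in Aint & (F i == G i %[mod e])%A]) ->
  (\prod_(i <- r | P i) F i == \prod_(i <- r | P i) G i %[mod e])%A.
Proof.
move=> FG; have [] : [/\ \prod_(i <- r | P i) F i \in Aint,
  \prod_(i <- r | P i) G i \in Aint &
  (\prod_(i <- r | P i) F i == \prod_(i <- r | P i) G i %[mod e])%A].
  apply: (big_rec2 (fun u v => [/\ u \in Aint, v \in Aint & (u == v %[mod e])%A])).
    by rewrite !Aint1 eqAmod_refl.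
  move=> i u v Pi [Au Av uv]; have [Af Ag fg] := FG i Pi.
  by split; rewrite ?rpredM // eqAmodM.
by [].
Qed.

Lemma prod_dvdA (I : Type) (r : seq I) (P : pred I) (F G : I -> algC) :
  (forall i, P i -> exists2 y, y \in Aint & F i = G i * y) ->
  exists2 y, y \in Aint & \prod_(i <- r | P i) F i = \prod_(i <- r | P i) G i * y.
Proof.
move=> FG; apply: (big_rec2 (fun u v => exists2 y, y \in Aint & u = v * y)).
  by exists 1; rewrite ?Aint1 ?mulr1.
move=> i u v Pi [y Ay ->]; have [t At ->] := FG i Pi.
by exists (t * y); [apply: rpredM | ring].
Qed.

Section PrimePower.

Variables (p : nat).
Hypothesis p_pr : prime p.

Let p_gt0 : (0 < p)%N := prime_gt0 p_pr.

(** The value at 1 of the cyclotomic polynomial of a prime power, obtained as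
    the quotient of the products of 1 - z over all roots of unity z other
    than 1 of order dividing p m and dividing m. *)
Lemma prod_prim_1sub (m : nat) (x : algC) : (p * m).-primitive_root x ->
  \prod_(1 <= i < p * m | ~~ (p %| i)%N) (1 - x ^+ i) = p%:R.
Proof.
move=> prim_x; have m_gt0 : (0 < m)%N.
  by have := prim_order_gt0 prim_x; rewrite muln_gt0 => /andP[].
have prim_xp : m.-primitive_root (x ^+ p).
  by have := dvdn_prim_root prim_x (dvdn_mull p (dvdnn m)); rewrite mulnK.
have := nontriv_prod_1sub prim_x; rewrite (bigID (dvdn p)) /= prod_multiples //.
have -> : \prod_(1 <= i < m) (1 - x ^+ (p * i)) = m%:R.
  rewrite -(nontriv_prod_1sub prim_xp); apply: eq_bigr => i _.
  by rewrite exprM.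
by rewrite natrM mulrC; apply: mulIf; rewrite pnatr_eq0 -lt0n.
Qed.

Variables (j : nat) (x : algC).
Hypothesis prim_x : (p ^ j.+1)%N.-primitive_root x.
Let N := (p ^ j.+1)%N.

Let N_gt0 : (0 < N)%N := prim_order_gt0 prim_x.
Let Ax : x \in Aint := Aint_prim_root prim_x.

Lemma prod_prim_1sub_ord :
  \prod_(i < N | ~~ (p %| i)%N) (1 - x ^+ i) = p%:R.
Proof.
rewrite -(big_mkord (fun i => ~~ (p %| i)%N) (fun i => 1 - x ^+ i)).
rewrite big_ltn_cond // dvdn0 /= /N expnS prod_prim_1sub //.
by rewrite -expnS.
Qed.

(** The factors 1 - x^i of p are associated to 1 - x, each x^i generating the
    same group as x. *)
Lemma p_dvd_1sub_exp : exists M t, t \in Aint /\ (1 - x) ^+ M = p%:R * t.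
Proof.
have [t At Et] : exists2 t, t \in Aint &
    \prod_(i < N | ~~ (p %| i)%N) (1 - x) = p%:R * t.
  rewrite -prod_prim_1sub_ord.
  apply: (big_ind2 (fun u v => exists2 t, t \in Aint & u = v * t)).
  - by exists 1; rewrite ?Aint1 ?mulr1.
  - move=> u v u' v' [t At ->] [t' At' ->]; exists (t * t'); last by ring.
    exact: rpredM.
  move=> i p'i; have prim_xi : N.-primitive_root (x ^+ i).
    rewrite (prim_root_exp_coprime _ prim_x) coprime_pexpr //.
    by rewrite coprime_sym prime_coprime.
  have [l El] := prim_rootP prim_xi (prim_expr_order prim_x); rewrite {1}El.
  by apply: dvdA_1sub_exp; apply: rpredX.
by move: Et; rewrite prodr_const => Et; eexists; exists t; split; last exact: Et.
Qed.

(** A power of 1 - x is a multiple of p, hence so is that power of m. *)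
Lemma dvdA_1sub_int (m : int) : (1 - x %| m%:~R)%A -> (p %| m)%Z.
Proof.
case/dvdAP=> z Az Em; have [M [t [At Et]]] := p_dvd_1sub_exp.
have p0 : (p : int) != 0 by rewrite eqz_nat -lt0n.
have [||n _ Emn] := @Aint_int_quotient (m ^+ M) p (t * z ^+ M) p0.
- by rewrite rpredM ?rpredX.
- by rewrite rmorphXn /= Em exprMn Et -mulrA.
have : (p %| m ^+ M)%Z by rewrite Emn dvdz_mulr.
by rewrite !dvdzE abszX Euclid_dvdX // => /andP[].
Qed.

(** Among the factors 1 - x^i of p, those with i = 1 and i = -1 make up the
    squared chord. Unless x has order 3, there is also a factor with i = 2, and
    the cofactor y is not a unit; when x has order 3, nothing is left. *)
Lemma p_eq_sqchord : odd p -> exists2 y, y \in Aint &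
  p%:R = sqchord x * y /\ (y = 1 \/ (1 - x ^+ 2 %| y)%A).
Proof.
move=> odd_p; have p_gt2 : (2 < p)%N by rewrite odd_prime_gt2.
have odd_N : odd N by rewrite oddX odd_p orbT.
have N_gt2 : (2 < N)%N.
  by rewrite (leq_trans p_gt2) // /N expnS leq_pmulr // expn_gt0 p_gt0.
have lt1 : (1 < N)%N by apply: ltnW.
have ltN : (N.-1 < N)%N by rewrite prednK.
rewrite -prod_prim_1sub_ord (bigD1 (Ordinal lt1)) /=; last first.
  by rewrite dvdn1 gtn_eqF // prime_gt1.
rewrite (bigD1 (Ordinal ltN)) /=; last first.
  rewrite -val_eqE /= [in X in _ && X]gtn_eqF ?andbT; last by rewrite -ltnS prednK.
  apply/negP=> p_dvd; have : (p %| N - N.-1)%N.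
    by apply: dvdn_sub => //; rewrite /N expnS dvdn_mulr.
  by rewrite -{1}(prednK N_gt0) subSnn dvdn1 gtn_eqF // prime_gt1.
set y := (X in _ * (_ * X)).
have Ay : y \in Aint.
  by apply: rpred_prod => i _; rewrite rpredB ?rpred1 ?rpredX.
exists y => //; split.
  rewrite mulrA expr1 /sqchord; congr (_ * (1 - _) * _).
  have x0 : x != 0 by rewrite (expr1_neq0 N_gt0) ?(prim_expr_order prim_x).
  by apply: (mulfI x0); rewrite -exprS prednK // divff // (prim_expr_order prim_x).
have [N4 | N3] := ltnP 3 N.
  right; have lt2 : (2 < N)%N by [].
  rewrite /y (bigD1 (Ordinal lt2)) /=; last first.
    rewrite -!val_eqE /= gtnNdvd //= ltn_eqF // -ltnS prednK //.
  rewrite dvdA_mulr //.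
  by apply: rpred_prod => i _; rewrite rpredB ?rpred1 ?rpredX.
left; have N_eq3 : N = 3 by lia.
rewrite /y big_pred0 // => -[i lt_iN]; rewrite -!val_eqE /=.
move: lt_iN; rewrite N_eq3; case: i => [|[|[|]]] //= _.
  by rewrite dvdn0.
all: by rewrite andbF.
Qed.

End PrimePower.

(** * Divisibility of dihedral values by p *)

Lemma evD f g x : ev (f + g) x = ev f x + ev g x.
Proof. by rewrite /ev rmorphD hornerD. Qed.
Lemma evN f x : ev (- f) x = - ev f x.
Proof. by rewrite /ev rmorphN hornerN. Qed.
Lemma evM f g x : ev (f * g) x = ev f x * ev g x.
Proof. by rewrite /ev rmorphM hornerM. Qed.
Lemma evC (c : int) x : ev c%:P x = c%:~R.
Proof. by rewrite /ev map_polyC hornerC. Qed.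
Lemma evX x : ev 'X x = x.
Proof. by rewrite /ev map_polyX hornerX. Qed.
Lemma evXn n x : ev 'X^n x = x ^+ n.
Proof. by rewrite /ev map_polyXn hornerXn. Qed.
Lemma ev1 f : ev f 1 = f.[1]%:~R.
Proof.
by rewrite /ev -[1 in LHS](rmorph1 (intr : {rmorphism int -> algC})) horner_map.
Qed.
Lemma ev_comp f g x : ev (f \Po g) x = ev f (ev g x).
Proof. by rewrite /ev map_comp_poly horner_comp. Qed.

Lemma Aint_ev f x : x \in Aint -> ev f x \in Aint.
Proof.
move=> Ax; rewrite /ev horner_coef rpred_sum // => i _.
by rewrite rpredM ?rpredX // coef_map Aint_int.
Qed.

Lemma ev_factor1 f : exists r : {poly int}, f = f.[1]%:P + ('X - 1) * r.
Proof.
have /factor_theorem[r Er] : root (f - f.[1]%:P) 1.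
  by rewrite rootE hornerD hornerN hornerC subrr.
by exists r; rewrite -polyC1 mulrC -Er addrC subrK.
Qed.

(** Expand f to second order at 1. In f(x) f(1/x) the linear terms contribute
    multiples of the sum of x - 1 and 1/x - 1, which is minus the squared chord, while the
    square of x - 1 and the product of x - 1 and 1/x - 1 are integral multiples
    of it. *)
Lemma ev_selfconj_mod_sqchord f n x : (0 < n)%N -> x ^+ n = 1 ->
  exists2 s, s \in Aint & ev f x * ev f x^-1 = (f.[1] ^+ 2)%:~R + sqchord x * s.
Proof.
move=> n_gt0 xn; have x0 := expr1_neq0 n_gt0 xn.
have Ax := Aint_root1 n_gt0 xn; have AxV := Aint_root1V n_gt0 xn.
have [r Er] := ev_factor1 f; have [t Et] := ev_factor1 r.
set c := f.[1] in Er *; set d := r.[1] in Et.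
exists (c%:~R * (- d%:~R - x * ev t x - x^-1 * ev t x^-1) + ev r x * ev r x^-1).
  by rewrite !(rpredD, rpredB, rpredN, rpredM, Aint_ev, Aint_int).
have E y : ev f y = c%:~R + (y - 1) * ev r y.
  by rewrite Er evD evM evD evN evX !evC.
have E' y : ev r y = d%:~R + (y - 1) * ev t y.
  by rewrite Et evD evM evD evN evX !evC.
rewrite !E !E' rmorphXn /= /sqchord.
move: (ev t x) (ev t x^-1) (c%:~R) (d%:~R) => a b u v.
by field.
Qed.

Lemma dihedral_norm_mod_sqchord f g n x : (0 < n)%N -> x ^+ n = 1 ->
  exists2 s, s \in Aint &
    dihedral_norm f g x = (f.[1] ^+ 2 - g.[1] ^+ 2)%:~R + sqchord x * s.
Proof.
move=> n_gt0 xn; have [s As Es] := ev_selfconj_mod_sqchord f n_gt0 xn.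
have [t At Et] := ev_selfconj_mod_sqchord g n_gt0 xn.
exists (s - t); first exact: rpredB.
by rewrite /dihedral_norm Es Et rmorphB /=; ring.
Qed.

Section Forward.

Variables (p k : nat) (w : algC).
Hypotheses (p_pr : prime p) (odd_p : odd p) (k_gt0 : (0 < k)%N).
Let n := (p ^ k)%N.
Hypothesis prim_w : n.-primitive_root w.

Let n_gt0 : (0 < n)%N := prim_order_gt0 prim_w.
Let n_gt1 : (1 < n)%N.
Proof. by rewrite /n -(exp1n k) ltn_exp2r // prime_gt1. Qed.

Lemma root_prim_order (x : algC) : x ^+ n = 1 -> x != 1 ->
  exists j, (p ^ j.+1)%N.-primitive_root x.
Proof.
move=> xn x1; have [m prim_x] := prim_order_exists n_gt0 xn.
case/(dvdn_pfactor _ _ p_pr) => -[|j] _ Em; last by exists j; rewrite -Em.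
by case/eqP: x1; rewrite -(prim_expr_order prim_x) Em expr1.
Qed.

Lemma p_eq_sqchord_root (x : algC) : x ^+ n = 1 -> x != 1 ->
  exists2 y, y \in Aint & p%:R = sqchord x * y /\ (y = 1 \/ (1 - w %| y)%A).
Proof.
move=> xn x1; have [j prim_x] := root_prim_order xn x1.
have [y Ay [Ey yP]] := p_eq_sqchord p_pr prim_x odd_p; exists y => //; split=> //.
case: yP => [|dvd_y]; [by left | right].
have [i Ei] := prim_rootP prim_w xn.
have [t At Et] := dvdA_1sub_exp (i * 2) (Aint_prim_root prim_w).
have [s As Es] := dvdAP dvd_y.
by rewrite Es Ei -exprM Et -mulrA dvdA_mulr // rpredM.
Qed.

Lemma dvdA_1subw_int (m : int) : (1 - w %| m%:~R)%A -> (p %| m)%Z.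
Proof.
by move: prim_w; rewrite /n -(prednK k_gt0) => pw; apply: (dvdA_1sub_int p_pr pw).
Qed.

Lemma dvdA_1subw_p : (1 - w %| p%:R)%A.
Proof.
have w1 : w != 1 by rewrite -[w]expr1 (prim_pow_neq1 prim_w).
have [y Ay [-> _]] := p_eq_sqchord_root (prim_expr_order prim_w) w1.
rewrite /sqchord -mulrA dvdA_mulr // rpredM // rpredB ?rpred1 //.
exact: Aint_root1V n_gt0 (prim_expr_order prim_w).
Qed.

Lemma Aint_sqchord i : sqchord (w ^+ i) \in Aint.
Proof.
rewrite rpredM // rpredB ?rpred1 ?rpredX ?(Aint_prim_root prim_w) //.
exact: Aint_root1V n_gt0 (prim_pow1 prim_w i).
Qed.

Lemma dvdA_1subw_sqchord i : (1 - w %| sqchord (w ^+ i))%A.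
Proof.
have [t At Et] := dvdA_1sub_exp i (Aint_prim_root prim_w).
rewrite /sqchord Et -mulrA dvdA_mulr // rpredM // rpredB ?rpred1 //.
exact: Aint_root1V n_gt0 (prim_pow1 prim_w i).
Qed.

(** Let c be the norm at 1. Modulo 1 - w the value is c^n, so p divides c; then
    each factor at a root other than 1 is an integral multiple of the squared
    chord, and the value is an integral, hence integer, multiple of c n^2. *)
Lemma dihedral_value_p (z : int) (f g : {poly int}) : z != 0 ->
    z%:~R = \prod_(i < n) dihedral_norm f g (w ^+ i) -> (p %| z)%Z ->
  (p%:Z ^+ (2 * k + 1) %| z)%Z.
Proof.
move=> z0 Ez p_z; set c := f.[1] ^+ 2 - g.[1] ^+ 2.
have normE i := dihedral_norm_mod_sqchord f g n_gt0 (prim_pow1 prim_w i).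
have p_c : (p %| c)%Z.
  have : (1 - w %| (c ^+ n)%:~R)%A.
    rewrite -eqAmod0 rmorphXn /=; have <- : \prod_(i < n) c%:~R = c%:~R ^+ n :> algC.
      by rewrite prodr_const card_ord.
    apply: (@eqAmod_trans _ z%:~R); last first.
      case/dvdzP: p_z => m ->; rewrite eqAmod0 rmorphM /= mulrC.
      have [t At Et] := dvdAP dvdA_1subw_p.
      by rewrite -[(p : int)%:~R]/(p%:R) Et -mulrA dvdA_mulr // rpredM // Aint_int.
    rewrite Ez; apply: eqAmod_prod => i _; have [s As ->] := normE i.
    have AWs : sqchord (w ^+ i) * s \in Aint := rpredM (Aint_sqchord i) As.
    rewrite Aint_int (rpredD (Aint_int _) AWs); split=> //.
    have [t At ->] := dvdAP (dvdA_1subw_sqchord i).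
    rewrite /eqAmod -mulrA opprD addrA subrr sub0r -mulrN dvdA_mulr // rpredN.
    exact: rpredM.
  by move/dvdA_1subw_int; rewrite !dvdzE abszX Euclid_dvdX // => /andP[].
have [c' Ec] := dvdzP p_c.
have [Y AY EY] : exists2 Y, Y \in Aint &
    \prod_(1 <= i < n) dihedral_norm f g (w ^+ i) =
    \prod_(1 <= i < n) sqchord (w ^+ i) * Y.
  rewrite big_nat [\prod_(1 <= i < n) sqchord _]big_nat; apply: prod_dvdA => i lt_i.
  have [s As ->] := normE i.
  have [y Ay [Ey _]] :=
    p_eq_sqchord_root (prim_pow1 prim_w i) (prim_pow_neq1 prim_w lt_i).
  exists (c'%:~R * y + s); first by rewrite rpredD // rpredM ?Aint_int.
  by rewrite -/c Ec rmorphM /= -[(p : int)%:~R]/(p%:R) Ey; ring.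
have Ez' : z%:~R = (c * n%:Z ^+ 2)%:~R * Y.
  rewrite Ez (prod_roots_split prim_w) EY (nontriv_prod_sqchord prim_w) mulrA.
  by rewrite rmorphM rmorphXn /= /dihedral_norm invr1 !ev1 rmorphB !rmorphXn.
have d0 : c * n%:Z ^+ 2 != 0.
  apply: contraNneq z0 => d0; apply/eqP; apply: (@intr_inj algC).
  by rewrite Ez' d0 mul0r.
have [m _ ->] := Aint_int_quotient d0 AY Ez'.
rewrite dvdz_mulr // addn1 (exprS p%:Z); apply: dvdz_mul => //.
by rewrite /n -[X in (_ %| X ^+ _)%Z]natz natrX natz -exprM mulnC dvdzz.
Qed.

End Forward.

(** * Palindromic functions and the values they give *)

(** Both e and g are integral, so that the constant term e has the parity of
    H 1; a symmetric Laurent polynomial is determined by its half g. *)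
Definition palindromic (n : nat) (H : algC -> algC) :=
  exists (e : int) (g : {poly int}),
    forall x, x ^+ n = 1 -> H x = e%:~R + ev g x + ev g x^-1.

(** The Dirichlet kernel, that is x^-m (1 + x + ... + x^2m). *)
Definition dirichlet (m : nat) (x : algC) : algC :=
  1 + \sum_(i < m) (x ^+ i.+1 + x^-1 ^+ i.+1).

Lemma ev_sum (I : Type) (r : seq I) (P : pred I) (F : I -> {poly int}) x :
  ev (\sum_(i <- r | P i) F i) x = \sum_(i <- r | P i) ev (F i) x.
Proof. by rewrite /ev rmorph_sum horner_sum. Qed.

Section Palindromic.

Variable n : nat.
Hypothesis n_gt0 : (0 < n)%N.

Lemma pal_int (c : int) : palindromic n (fun=> c%:~R).
Proof. by exists c, 0; move=> x _; rewrite /ev rmorph0 !horner0 !addr0. Qed.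

Lemma pal_sqchord : palindromic n sqchord.
Proof.
exists 2, (- 'X) => x xn; have x0 := expr1_neq0 n_gt0 xn.
by rewrite !evN !evX /sqchord; field.
Qed.

Lemma pal_dirichlet m : palindromic n (dirichlet m).
Proof.
exists 1, (\sum_(i < m) 'X^(i.+1)) => x _; rewrite !ev_sum -addrA -big_split /=.
by congr (_ + _); apply: eq_bigr => i _; rewrite !evXn.
Qed.

Lemma palD F G : palindromic n F -> palindromic n G ->
  palindromic n (fun x => F x + G x).
Proof.
move=> [e [f Ef]] [c [g Eg]]; exists (e + c), (f + g) => x xn.
by rewrite Ef // Eg // !evD rmorphD /=; ring.
Qed.

Lemma palM F G : palindromic n F -> palindromic n G ->
  palindromic n (fun x => F x * G x).
Proof.
move=> [e [f Ef]] [c [g Eg]].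
exists (e * c), (e%:P * g + c%:P * f + f * g + f * (g \Po 'X^(n.-1))) => x xn.
have xV (y : algC) : y ^+ n = 1 -> y ^+ n.-1 = y^-1.
  move=> yn; have y0 := expr1_neq0 n_gt0 yn; apply: (mulfI y0).
  by rewrite -exprS prednK // yn divff.
have xVn : x^-1 ^+ n = 1 by rewrite exprVn xn invr1.
rewrite Ef // Eg // !evD !evM !ev_comp !evXn !evC !xV // invrK rmorphM /=; ring.
Qed.

Lemma pal_exp a F : palindromic n F -> palindromic n (fun x => F (x ^+ a)).
Proof.
move=> [e [f Ef]]; exists e, (f \Po 'X^a) => x xn.
by rewrite Ef ?ev_comp ?evXn ?exprVn // exprAC xn expr1n.
Qed.

End Palindromic.

Lemma dirichlet1 m : dirichlet m 1 = m.*2.+1%:R.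
Proof.
rewrite /dirichlet (eq_bigr (fun=> 2%:R)) => [|i _].
  by rewrite sumr_const card_ord -mulrnA mul2n -[1]/(1%:R) -natrD add1n.
by rewrite invr1 !expr1n.
Qed.

Lemma dirichlet_mul m x : x != 0 ->
  (x - 1) * dirichlet m x = x ^+ m.+1 - x^-1 ^+ m.
Proof.
move=> x0; elim: m => [|m IHm]; first by rewrite /dirichlet big_ord0 addr0 mulr1.
rewrite /dirichlet big_ord_recr /= addrA -/(dirichlet m x) mulrDr IHm.
by rewrite !exprS; move: (x ^+ m) (x^-1 ^+ m) => u v; field.
Qed.

Lemma dirichlet_root m x : x ^+ m.*2.+1 = 1 -> x != 1 -> dirichlet m x = 0.
Proof.
move=> xm x1; have x0 := expr1_neq0 (ltn0Sn _) xm.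
apply: (mulfI (x := x - 1)); first by rewrite subr_eq0.
rewrite mulr0 dirichlet_mul // exprVn; apply/eqP; rewrite subr_eq0; apply/eqP.
apply: (mulIf (expf_neq0 m x0)).
by rewrite mulVf ?expf_neq0 // -exprD addSn addnn.
Qed.

Definition quantum (a : nat) : {poly int} := \sum_(j < a) 'X^j.

Lemma ev_quantum a x : ev (quantum a) x = \sum_(j < a) x ^+ j.
Proof. by rewrite ev_sum; apply: eq_bigr => j _; rewrite evXn. Qed.

Section Values.

Variables (n : nat) (w : algC).
Hypotheses (n_gt1 : (1 < n)%N) (prim_w : n.-primitive_root w).

Let n_gt0 : (0 < n)%N := ltnW n_gt1.
Local Notation value := (int_group_det_value 'D_(2 * n)).

(** Since H 1 is odd, so is e, and its even part can be moved into g: H is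
    1 - g - g(1/x) for some g, which is the norm of the pair 1 - g, g. *)
Lemma pal_value (H : algC -> algC) (c : int) :
    palindromic n H -> H 1 = (c *+ 2 + 1)%:~R ->
  exists2 z, value z & z%:~R = \prod_(i < n) H (w ^+ i).
Proof.
move=> [e [g Eg]] H1; have [e' Ee] : exists e', e = e' *+ 2 + 1.
  have := Eg 1 (expr1n _ n); rewrite H1 invr1 ev1 -!rmorphD /=.
  move/(@intr_inj algC) => E; exists (c - g.[1]); lia.
pose g' := - (g + e'%:P).
have [z valz Ez] := dihedral_norm_value n_gt1 prim_w (1 - g') g'.
exists z => //; rewrite Ez.
apply: eq_bigr => i _.
rewrite (Eg _ (prim_pow1 prim_w i)) /dihedral_norm Ee.
have ev_1 y : ev 1 y = 1 by rewrite -[1 in LHS]polyC1 evC.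
rewrite /g' !evD !evN !evD !ev_1 !evC rmorphD rmorphMn rmorph1 /=; ring.
Qed.

Lemma pal_value_prod (H : algC -> algC) (c d : int) :
    palindromic n H -> H 1 = (c *+ 2 + 1)%:~R ->
    \prod_(1 <= i < n) H (w ^+ i) = d%:~R ->
  value ((c *+ 2 + 1) * d).
Proof.
move=> palH H1 Hd; have [z valz Ez] := pal_value palH H1.
suff -> : (c *+ 2 + 1) * d = z by [].
by apply: (@intr_inj algC); rewrite Ez (prod_roots_split prim_w) H1 Hd rmorphM.
Qed.

Hypothesis odd_n : odd n.

(** With f = [s] and g = [t], where [a] = 1 + x + ... + x^(a-1), the norm at x is
    x^(1-s) [s+t] [s-t], and each of the three factors has product 1 over the
    nontrivial roots. *)
Lemma value_diff_squares (s t : nat) : (t <= s)%N ->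
    coprime n (s + t) -> coprime n (s - t) ->
  value ((s + t) * (s - t))%N.
Proof.
move=> le_ts co_add co_sub.
have [z valz Ez] := dihedral_norm_value n_gt1 prim_w (quantum s) (quantum t).
suff -> : Posz ((s + t) * (s - t)) = z by [].
apply: (@intr_inj algC); rewrite Ez (prod_roots_split prim_w).
have -> : dihedral_norm (quantum s) (quantum t) 1 = ((s + t) * (s - t))%:R.
  rewrite /dihedral_norm invr1 !ev_quantum.
  have q1 a : \sum_(j < a) 1 ^+ j = a%:R :> algC.
    rewrite (eq_bigr (fun=> 1)) => [|j _]; last by rewrite expr1n.
    by rewrite sumr_const card_ord.
  by rewrite !q1 natrM natrD natrB //; ring.
have nz : \prod_(1 <= i < n) (w ^+ i) ^+ s = 1.
  by rewrite prodrXl (nontriv_prod_id prim_w odd_n) expr1n.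
rewrite -[LHS]mulr1; congr (_ * _).
(* Multiplying the norm by x^s, whose product is 1, clears the denominators. *)
set P := (RHS); transitivity ((\prod_(1 <= i < n) (w ^+ i) ^+ s) * P); last first.
  by rewrite nz mul1r.
rewrite -big_split /=.
transitivity (\prod_(1 <= i < n) (w ^+ i *
    (\sum_(j < s + t) (w ^+ i) ^+ j) * (\sum_(j < s - t) (w ^+ i) ^+ j))).
  rewrite !big_split /= (nontriv_prod_id prim_w odd_n).
  by rewrite !(nontriv_prod_quantum prim_w) ?mulr1.
apply: (eq_nontriv_prod prim_w
  (F := fun x => x * (\sum_(j < s + t) x ^+ j) * (\sum_(j < s - t) x ^+ j))
  (G := fun x => x ^+ s * dihedral_norm (quantum s) (quantum t) x)).
move=> x xn x1; have x0 := expr1_neq0 n_gt0 xn.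
have xm1 : x - 1 != 0 by rewrite subr_eq0.
have xVm1 : x^-1 - 1 != 0 by rewrite subr_eq0 invr_eq1.
have q1 a : \sum_(j < a) x ^+ j = (x ^+ a - 1) / (x - 1).
  by rewrite subrX1 mulrC mulKf.
have qV a : \sum_(j < a) x^-1 ^+ j = (x^-1 ^+ a - 1) / (x^-1 - 1).
  by rewrite subrX1 mulrC mulKf.
rewrite /dihedral_norm !ev_quantum !q1 !qV exprD expfB_cond; last first.
  by rewrite (negPf x0).
rewrite !exprVn; have := expf_neq0 s x0; have := expf_neq0 t x0.
move: (x ^+ s) (x ^+ t) => X Y Y0 X0; field.
by rewrite x0 Y0 xm1 X0 !andbT /= mulN1r subr_eq0 eq_sym x1.
Qed.

(** An odd m is a difference of consecutive squares. *)
Lemma value_coprime (m : nat) : odd m -> coprime n m -> value m.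
Proof.
move=> odd_m co_m; rewrite -(odd_double_half m) odd_m add1n.
have := @value_diff_squares m./2.+1 m./2 (leqnSn _).
rewrite addSn addnn subSnn muln1; apply; last exact: coprimen1.
by move: co_m; rewrite -{1}(odd_double_half m) odd_m add1n.
Qed.

(** Write 2^a as 2^(a-1) times 2, a difference of squares. *)
Lemma value_pow2 (a : nat) : (2 <= a)%N -> value (2 ^ a)%N.
Proof.
case: a => [|[|a]] // _; have := @value_diff_squares (2 ^ a).+1 (2 ^ a).-1.
have a_gt0 : (0 < 2 ^ a)%N by rewrite expn_gt0.
have -> : ((2 ^ a).+1 + (2 ^ a).-1 = 2 ^ a.+1)%N by rewrite expnS; lia.
have -> : ((2 ^ a).+1 - (2 ^ a).-1 = 2)%N by lia.
rewrite -expnSr; apply; first by lia.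
  by rewrite coprime_pexpr // coprimen2.
by rewrite coprimen2.
Qed.

Lemma value_opp1 : value (-1).
Proof.
have := @pal_value_prod (fun=> -1) (-1) 1 _ _ _; rewrite mulr1; apply.
- exact: (@pal_int n (-1)).
- by rewrite rmorphD rmorphMn /= rmorphN rmorph1 mulr2n addrNK.
by rewrite prodr_const_nat -signr_odd oddB // odd_n.
Qed.

End Values.

(** * Palindromic units of norm one *)

Section UnitProducts.

Variables (m : nat) (w : algC).
Hypotheses (odd_m : odd m) (prim_w : m.-primitive_root w).

Let m_gt0 : (0 < m)%N := prim_order_gt0 prim_w.

Lemma nontriv_prod1_div (F G H : algC -> algC) :
    (forall x, x ^+ m = 1 -> F x * G x = H x) ->
    \prod_(1 <= i < m) F (w ^+ i) = 1 -> \prod_(1 <= i < m) H (w ^+ i) = 1 ->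
  \prod_(1 <= i < m) G (w ^+ i) = 1.
Proof.
move=> FGH F1 H1; rewrite -[LHS]mul1r -{1}F1 -big_split /= -[RHS]H1.
by apply: eq_bigr => i _; rewrite FGH ?prim_pow1.
Qed.

Lemma nontriv_prod1_opp (F : algC -> algC) :
    \prod_(1 <= i < m) F (w ^+ i) = 1 -> \prod_(1 <= i < m) (- F (w ^+ i)) = 1.
Proof.
move=> F1; rewrite (eq_bigr (fun i => -1 * F (w ^+ i))) => [|i _]; last first.
  by rewrite mulN1r.
rewrite big_split /= F1 mulr1 prodr_const_nat -signr_odd oddB // ?odd_m //.
Qed.

Lemma nontriv_prod_1add : \prod_(1 <= i < m) (1 + w ^+ i) = 1.
Proof.
rewrite -[RHS](nontriv_prod_quantum prim_w (a := 2)) ?coprimen2 //.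
by apply: eq_bigr => i _; rewrite 2!big_ord_recr big_ord0 /= add0r.
Qed.

(** The factor is x + 1/x, and x (x + 1/x) = 1 + x^2. *)
Lemma nontriv_prod_2sub_sqchord : \prod_(1 <= i < m) (2 - sqchord (w ^+ i)) = 1.
Proof.
apply: (nontriv_prod1_div (F := id) (G := fun x => 2 - sqchord x)
  (H := fun x => 1 + x ^+ 2)).
- by move=> x xn; have x0 := expr1_neq0 m_gt0 xn; rewrite /sqchord; field.
- exact: (nontriv_prod_id prim_w odd_m).
rewrite (nontriv_prod_pow prim_w (fun x => 1 + x)) ?coprimen2 //.
exact: nontriv_prod_1add.
Qed.

(** The factor is x + 1 + 1/x. *)
Lemma nontriv_prod_3sub_sqchord : coprime m 3 ->
  \prod_(1 <= i < m) (3 - sqchord (w ^+ i)) = 1.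
Proof.
move=> co_m3; apply: (nontriv_prod1_div (F := id) (G := fun x => 3 - sqchord x)
  (H := fun x => \sum_(j < 3) x ^+ j)).
- move=> x xn; have x0 := expr1_neq0 m_gt0 xn.
  by rewrite 3!big_ord_recr big_ord0 /= /sqchord; field.
- exact: (nontriv_prod_id prim_w odd_m).
exact: (nontriv_prod_quantum prim_w co_m3).
Qed.

(** The factor is x - 1 + 1/x, and x (1 + x) (x - 1 + 1/x) = 1 + x^3. *)
Lemma nontriv_prod_1sub_sqchord : coprime m 3 ->
  \prod_(1 <= i < m) (1 - sqchord (w ^+ i)) = 1.
Proof.
move=> co_m3; apply: (nontriv_prod1_div (F := fun x => x * (1 + x))
  (G := fun x => 1 - sqchord x) (H := fun x => 1 + x ^+ 3)).
- by move=> x xn; have x0 := expr1_neq0 m_gt0 xn; rewrite /sqchord; field.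
- by rewrite big_split /= (nontriv_prod_id prim_w odd_m) nontriv_prod_1add mulr1.
rewrite (nontriv_prod_pow prim_w (fun x => 1 + x)) //.
exact: nontriv_prod_1add.
Qed.

End UnitProducts.

(** * Values divisible by p, for a general odd prime power *)

Section PrimePowerValues.

Variables (p k : nat) (w : algC).
Hypotheses (p_pr : prime p) (odd_p : odd p) (k_gt0 : (0 < k)%N).
Let n := (p ^ k)%N.
Hypothesis prim_w : n.-primitive_root w.

Local Notation value := (int_group_det_value 'D_(2 * (p ^ k)%N)).

Let n_gt1 : (1 < n)%N.
Proof. by rewrite /n -(exp1n k) ltn_exp2r // prime_gt1. Qed.
Let n_gt0 : (0 < n)%N := ltnW n_gt1.
Let odd_n : odd n.
Proof. by rewrite /n oddX odd_p orbT. Qed.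

Lemma pal_value_nat (H : algC -> algC) (u d : nat) : odd u ->
    palindromic n H -> H 1 = u%:R -> \prod_(1 <= i < n) H (w ^+ i) = d%:R ->
  value (u * d)%N.
Proof.
move=> odd_u palH H1 Hd.
have Eu : Posz u = Posz u./2 *+ 2 + 1 by have := odd_double_half u; lia.
by rewrite PoszM Eu; apply: (pal_value_prod n_gt1 prim_w palH) => //; rewrite -Eu.
Qed.

(** The sum 1 + x + ... + x^(n-1) vanishes at the nontrivial roots, where it leaves
    the squared chord alone, and changes the value at 1 by n. The product of
    squared chords accounts for p^2k and the value at 1 for p^(b-2k). *)
Lemma value_p_power (b : nat) : (3 * k <= b)%N -> value (p ^ b)%N.
Proof.
move=> le_b; pose t := (p ^ (b - 3 * k))%N; pose S := dirichlet n./2.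
have nE : n./2.*2.+1 = n by rewrite -[RHS](odd_double_half n) odd_n.
have -> : (p ^ b = (t * n) * n ^ 2)%N.
  by rewrite /t /n -mulnA -expnS -expnM -expnD; congr (_ ^ _)%N; lia.
apply: (@pal_value_nat (fun x => sqchord x + t%:~R * S x)).
- by rewrite oddM odd_n oddX odd_p orbT.
- apply: palD (pal_sqchord n_gt0) _; apply: palM => //; first exact: pal_int.
  exact: pal_dirichlet.
- by rewrite /sqchord subrr mul0r add0r /S dirichlet1 nE natrM.
rewrite natrX -(nontriv_prod_sqchord prim_w); apply: (eq_nontriv_prod prim_w
  (F := fun x => sqchord x + t%:~R * S x) (G := sqchord)) => x xn x1.
by rewrite /S dirichlet_root ?nE // mulr0 addr0.
Qed.

(** The Laurent polynomial is H = p - 2 chi, with chi the squared chord. At a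
    nontrivial root, p = chi y and H = chi (y - 2), so it remains to see that the
    product of the y - 2 is prime to p. As y is 1 or a multiple of 1 - w, the
    product (y - 2)(y + 1) is -2 modulo 1 - w in both cases. *)
Lemma value_exact : exists z, [/\ value z, (p%:Z ^+ (2 * k + 1) %| z)%Z &
  ~~ (p%:Z ^+ (2 * k + 2) %| z)%Z].
Proof.
pose H x := p%:~R + (-2)%:~R * sqchord x.
have [||z valz Ez] := @pal_value _ _ n_gt1 prim_w H p./2.
- apply: palD; first exact: pal_int.
  by apply: palM => //; [apply: pal_int | apply: pal_sqchord].
- rewrite /H /sqchord subrr mul0r mulr0 addr0; congr (_%:~R).
  by have := odd_double_half p; lia.
have [Y [Y' [AY AY' EY YY']]] : exists Y Y', [/\ Y \in Aint, Y' \in Aint,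
    \prod_(1 <= i < n) H (w ^+ i) = \prod_(1 <= i < n) sqchord (w ^+ i) * Y &
    (Y * Y' == \prod_(1 <= i < n) (-2)%:~R %[mod 1 - w])%A].
  rewrite [\prod_(1 <= i < n) H _]big_nat [\prod_(1 <= i < n) sqchord _]big_nat.
  rewrite [\prod_(1 <= i < n) _%:~R]big_nat.
  apply: (big_rec3 (fun u v d => exists Y Y', [/\ Y \in Aint, Y' \in Aint,
    u = v * Y & (Y * Y' == d %[mod 1 - w])%A])).
    by exists 1, 1; rewrite !Aint1 !mulr1 eqAmod_refl.
  move=> i u v d lt_i [Y [Y' [AY AY' -> YY']]].
  have [y Ay [Ey yP]] := p_eq_sqchord_root p_pr odd_p prim_w
      (prim_pow1 prim_w i) (prim_pow_neq1 prim_w lt_i).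
  exists ((y - 2) * Y), ((y + 1) * Y'); split.
  - by rewrite rpredM // rpredB // (Aint_int 2).
  - by rewrite rpredM // rpredD // Aint1.
  - by rewrite /H -[(p : int)%:~R]/(p%:R) Ey; ring.
  rewrite mulrACA mulrC [_ * d]mulrC; apply: eqAmodM => //.
  - by rewrite rpredM.
  - exact: Aint_int.
  (* The difference is y (y - 1), where y or y - 1 is divisible by 1 - w. *)
  rewrite /eqAmod; have -> : (y - 2) * (y + 1) - (-2)%:~R = y * (y - 1) by ring.
  case: yP => [-> | /dvdAP[s As ->]]; last first.
    by rewrite -mulrA dvdA_mulr // rpredM // rpredB ?rpredM ?rpredB ?Aint1 //
      (Aint_prim_root prim_w).
  by rewrite subrr mulr0 -(mulr0 (1 - w)) dvdA_mulr ?Aint0.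
have p0 : p%:Z != 0 by rewrite eqz_nat -lt0n prime_gt0.
have Epn : p%:Z ^+ (2 * k + 1) = p%:Z * n%:Z ^+ 2.
  rewrite addn1 exprS mulnC exprM; congr (_ * _ ^+ _).
  by rewrite /n -[Posz (p ^ k)]natz natrX natz.
have Ez' : z%:~R = (p%:Z ^+ (2 * k + 1))%:~R * Y.
  rewrite Ez (prod_roots_split prim_w) EY (nontriv_prod_sqchord prim_w) mulrA Epn.
  by rewrite /H /sqchord subrr mul0r mulr0 addr0 rmorphM rmorphXn.
have [m Ym zm] := Aint_int_quotient (expf_neq0 _ p0) AY Ez'.
exists z; split=> //; first by rewrite zm dvdz_mulr.
have -> : (2 * k + 2 = (2 * k + 1).+1)%N by lia.
rewrite exprSr zm dvdz_mul2l ?expf_neq0 //.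
apply/negP=> /dvdzP[c Ec]; rewrite mulrC in Ec.
have : (1 - w %| ((-2) ^+ n.-1)%:~R)%A.
  rewrite -eqAmod0 rmorphXn /= -subn1 -prodr_const_nat eqAmod_sym.
  apply: eqAmod_trans YY'; rewrite eqAmod_sym eqAmod0 Ym Ec rmorphM /=.
  have [t At Ep] := dvdAP (dvdA_1subw_p p_pr odd_p k_gt0 prim_w).
  by rewrite -[(p : int)%:~R]/(p%:R) Ep -!mulrA dvdA_mulr // !rpredM // Aint_int.
move/(dvdA_1subw_int p_pr k_gt0 prim_w).
rewrite !dvdzE abszX Euclid_dvdX // => /andP[p_dvd2 _].
have := dvdn_leq (isT : (0 < 2)%N) p_dvd2.
by rewrite leqNgt odd_prime_gt2.
Qed.

End PrimePowerValues.

(** * The exponent 5 for p = 3, 5, 7 *)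

Section PrimeSquareValues.

Variables (p : nat) (w : algC).
Hypotheses (p_pr : prime p) (odd_p : odd p).
Hypothesis prim_w : (p ^ 2)%N.-primitive_root w.
Let y := w ^+ p.

Let p_gt0 : (0 < p)%N := prime_gt0 p_pr.

Let prim_y : p.-primitive_root y.
Proof.
have := dvdn_prim_root prim_w (dvdn_mulr p (dvdnn p)).
by rewrite mulnK // expnS expn1 mulnK.
Qed.

Lemma nontriv_prod_levels (F : algC -> algC) :
  \prod_(1 <= i < p ^ 2) F (w ^+ i) =
  \prod_(1 <= i < p) F (y ^+ i) * \prod_(1 <= i < p ^ 2 | ~~ (p %| i)%N) F (w ^+ i).
Proof.
rewrite (bigID (dvdn p)) /=; congr (_ * _).
rewrite [(p ^ 2)%N]expnS expn1 prod_multiples //.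
by apply: eq_bigr => i _; rewrite exprM.
Qed.

(** U has product 1 over all nontrivial p^2-th roots and over those of order p,
    hence over those of order p^2. *)
Lemma value_p_exponent5 (H U V : algC -> algC) :
    palindromic (p ^ 2) H -> H 1 = p%:R ->
    (forall x, x ^+ (p ^ 2) = 1 -> x ^+ p != 1 -> H x = sqchord x * U x) ->
    (forall x, x ^+ p = 1 -> x != 1 -> H x = sqchord x * V x) ->
    \prod_(1 <= i < p ^ 2) U (w ^+ i) = 1 ->
    \prod_(1 <= i < p) U (y ^+ i) = 1 ->
    \prod_(1 <= i < p) V (y ^+ i) = 1 ->
  int_group_det_value 'D_(2 * (p ^ 2)%N) (p ^ 5)%N.
Proof.
move=> palH H1 HU HV Uw Uy Vy.
have -> : (p ^ 5 = p * (p ^ 2) ^ 2)%N by rewrite -expnM -expnS.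
apply: (pal_value_nat p_pr odd_p _ prim_w) palH H1 _ => //.
rewrite natrX -(nontriv_prod_sqchord prim_w) !nontriv_prod_levels.
have -> : \prod_(1 <= i < p) H (y ^+ i) = \prod_(1 <= i < p) sqchord (y ^+ i).
  transitivity (\prod_(1 <= i < p) sqchord (y ^+ i) * \prod_(1 <= i < p) V (y ^+ i)).
    rewrite -big_split /=.
    exact: (eq_nontriv_prod prim_y (F := H) (G := fun x => sqchord x * V x)).
  by rewrite Vy mulr1.
congr (_ * _); have := nontriv_prod_levels U; rewrite Uw Uy mul1r => U1.
rewrite -[RHS]mulr1 [X in _ = _ * X]U1 -big_split /=.
rewrite big_nat_cond [RHS]big_nat_cond; apply: eq_bigr => i /andP[lt_i p'i].
apply: HU; first exact: prim_pow1.
by rewrite -exprM -(prim_order_dvd prim_w) expnS expn1 dvdn_pmul2r.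
Qed.

Lemma dirichlet_order_p x : x ^+ (p ^ 2) = 1 -> x ^+ p != 1 ->
  dirichlet p./2 (x ^+ p) = 0.
Proof.
move=> xn xp; apply: dirichlet_root => //.
rewrite -[p./2.*2.+1]add1n -[1%N]/(true : nat) -odd_p odd_double_half -exprM.
by rewrite -[(p * p)%N]/(p ^ 2)%N.
Qed.

End PrimeSquareValues.

Lemma dirichlet1_sqchord x : x != 0 -> dirichlet 1 x = 3 - sqchord x.
Proof. by move=> x0; rewrite /dirichlet big_ord1 !expr1 /sqchord; field. Qed.

Lemma dirichlet2_sqchord x : x != 0 ->
  dirichlet 2 x = 5 - 5 * sqchord x + sqchord x ^+ 2.
Proof.
by move=> x0; rewrite /dirichlet !big_ord_recr big_ord0 /= !exprS expr0 /sqchord; field.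
Qed.

Lemma dirichlet3_sqchord x : x != 0 ->
  dirichlet 3 x = 7 - 14 * sqchord x + 7 * sqchord x ^+ 2 - sqchord x ^+ 3.
Proof.
by move=> x0; rewrite /dirichlet !big_ord_recr big_ord0 /= !exprS expr0 /sqchord; field.
Qed.

Lemma pal_sub n F G : (0 < n)%N -> palindromic n F -> palindromic n G ->
  palindromic n (fun x => F x - G x).
Proof.
move=> n_gt0 pF pG; have [e [f E]] := palD pF (palM n_gt0 (pal_int n (-1)) pG).
by exists e, f => x xn; rewrite -E // rmorphN mulN1r.
Qed.

Lemma sqchord1 : sqchord 1 = 0. Proof. by rewrite /sqchord subrr mul0r. Qed.

Lemma value_3_exponent5 : int_group_det_value 'D_(2 * (3 ^ 2)%N) (3 ^ 5)%N.
Proof.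
have [w prim_w] := C_prim_root_exists (isT : (0 < 3 ^ 2)%N).
pose H x := sqchord x + (1%:~R - sqchord x) * dirichlet 1 (x ^+ 3).
apply: (value_p_exponent5 (H := H) (U := fun=> 1) (V := fun=> -1) _ _ prim_w) => //.
- have pW := @pal_sqchord 9 isT; have p1 := pal_int 9 1.
  apply: palD => //; apply: palM (pal_sub _ p1 pW) _ => //.
  exact/pal_exp/pal_dirichlet.
- by rewrite /H sqchord1 subr0 add0r mul1r expr1n dirichlet1.
- move=> x xn x3; rewrite /H (dirichlet_order_p (p := 3)) //.
  by rewrite mulr0 addr0 mulr1.
- move=> x x3 x1; have x0 := expr1_neq0 (isT : (0 < 3)%N) x3.
  have := dirichlet_root (m := 1) x3 x1; rewrite dirichlet1_sqchord // => E0.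
  apply/eqP; rewrite -subr_eq0 /H x3 dirichlet1 -[(1.*2.+1)%N]/3%N; apply/eqP.
  by transitivity (3 - sqchord x) => //; ring.
- by rewrite big1.
- by rewrite big1.
by rewrite prodr_const_nat -signr_odd.
Qed.

Lemma value_5_exponent5 : int_group_det_value 'D_(2 * (5 ^ 2)%N) (5 ^ 5)%N.
Proof.
have [w prim_w] := C_prim_root_exists (isT : (0 < 5 ^ 2)%N).
pose H x :=
  sqchord x * (sqchord x - 1%:~R) + (1%:~R - sqchord x) * dirichlet 2 (x ^+ 5).
have U1 m z : odd m -> m.-primitive_root z -> coprime m 3 ->
    \prod_(1 <= i < m) (sqchord (z ^+ i) - 1) = 1.
  move=> odd_m prim_z co_m3; rewrite -[RHS](nontriv_prod1_opp odd_m prim_z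
    (F := fun x => 1 - sqchord x) (nontriv_prod_1sub_sqchord odd_m prim_z co_m3)).
  by apply: eq_bigr => i _; rewrite opprB.
apply: (value_p_exponent5 (H := H) (U := fun x => sqchord x - 1) (V := fun=> -1)
         _ _ prim_w) => //.
- have pW := @pal_sqchord 25 isT; have p1 := pal_int 25 1.
  apply: palD.
    by apply: palM => //; apply: pal_sub.
  apply: palM (pal_sub _ p1 pW) _ => //.
  exact/pal_exp/pal_dirichlet.
- by rewrite /H sqchord1 mul0r subr0 add0r mul1r expr1n dirichlet1.
- move=> x xn x5; rewrite /H (dirichlet_order_p (p := 5)) //.
  by rewrite mulr0 addr0.
- move=> x x5 x1; have x0 := expr1_neq0 (isT : (0 < 5)%N) x5.
  have := dirichlet_root (m := 2) x5 x1; rewrite dirichlet2_sqchord // => E0.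
  apply/eqP; rewrite -subr_eq0 /H x5 dirichlet1 -[(2.*2.+1)%N]/5%N; apply/eqP.
  by transitivity (5 - 5 * sqchord x + sqchord x ^+ 2) => //; ring.
- exact: U1.
- apply: U1 => //.
  by have := dvdn_prim_root prim_w (isT : (5 %| 5 ^ 2)%N).
by rewrite prodr_const_nat -signr_odd.
Qed.

(** With P = 7 - 14 chi + 7 chi^2 - chi^3, which is zero at the seventh roots
    other than 1, H - chi V is P (1 - chi - chi^2) there. *)
Lemma value_7_exponent5 : int_group_det_value 'D_(2 * (7 ^ 2)%N) (7 ^ 5)%N.
Proof.
have [w prim_w] := C_prim_root_exists (isT : (0 < 7 ^ 2)%N).
have prim_y : 7.-primitive_root (w ^+ 7).
  by have := dvdn_prim_root prim_w (isT : (7 %| 7 ^ 2)%N).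
pose H x := sqchord x * (2%:~R - sqchord x) * (2%:~R - sqchord x) +
  (1%:~R - sqchord x) * (sqchord x * sqchord x + (-3)%:~R * sqchord x + 1%:~R) *
  dirichlet 3 (x ^+ 7).
have U1 m z : odd m -> m.-primitive_root z ->
    \prod_(1 <= i < m) ((2 - sqchord (z ^+ i)) * (2 - sqchord (z ^+ i))) = 1.
  by move=> odd_m prim_z; rewrite big_split /= nontriv_prod_2sub_sqchord ?mulr1.
apply: (value_p_exponent5 (H := H) (U := fun x => (2 - sqchord x) * (2 - sqchord x))
  (V := fun x => - ((3 - sqchord x) * (1 - sqchord x) ^+ 3)) _ _ prim_w) => //.
- have pW := @pal_sqchord 49 isT; have pZ := pal_int 49; have gt0 : (0 < 49)%N by [].
  have p2 := pal_sub gt0 (pZ 2) pW.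
  apply: palD; first by do 2!apply: palM => //.
  apply: palM => //; last exact/pal_exp/pal_dirichlet.
  apply: palM => //; first exact: pal_sub.
  by do 2!apply: palD => //; apply: palM.
- by rewrite /H sqchord1 !mul0r mulr0 subr0 !add0r !mul1r expr1n dirichlet1.
- move=> x xn x7; rewrite /H (dirichlet_order_p (p := 7)) //.
  by rewrite mulr0 addr0 mulrA.
- move=> x x7 x1; have x0 := expr1_neq0 (isT : (0 < 7)%N) x7.
  have := dirichlet_root (m := 3) x7 x1; rewrite dirichlet3_sqchord // => E0.
  apply/eqP; rewrite -subr_eq0 /H x7 dirichlet1 -[(3.*2.+1)%N]/7%N; apply/eqP.
  transitivity ((7 - 14 * sqchord x + 7 * sqchord x ^+ 2 - sqchord x ^+ 3) *
                (1 - sqchord x - sqchord x ^+ 2)); first by ring.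
  by rewrite E0 mul0r.
- exact: U1.
- exact: U1.
apply: (@nontriv_prod1_opp 7 _ _ prim_y
  (fun x => (3 - sqchord x) * (1 - sqchord x) ^+ 3)) => //.
rewrite big_split /= prodrXl nontriv_prod_3sub_sqchord //.
by rewrite nontriv_prod_1sub_sqchord ?expr1n ?mulr1.
Qed.

(** * Assembling the classification *)

Lemma value_form_neq0 (p : nat) (B : nat -> Prop) (z : int) : prime p ->
  value_form p B z -> z != 0.
Proof.
move=> p_pr [a [b [m [co_m _ _ ->]]]].
rewrite !mulf_neq0 ?expf_neq0 //; first by rewrite eqz_nat -lt0n prime_gt0.
apply: contraTneq co_m => ->; rewrite coprimezE /= /coprime gcd0n.
by rewrite gtn_eqF // (@leq_trans (2 * 1)) // leq_mul2l prime_gt0.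
Qed.

Section DihedralPrimePower.

Variables p k : nat.
Hypotheses (p_pr : prime p) (odd_p : odd p) (k_gt0 : (0 < k)%N).

Local Notation value := (int_group_det_value 'D_(2 * (p ^ k)%N)).

Let p_gt0 : (0 < p)%N := prime_gt0 p_pr.
Let pk_gt1 : (1 < p ^ k)%N.
Proof. by rewrite -(exp1n k) ltn_exp2r // prime_gt1. Qed.

Lemma nat_factor_2p (N : nat) : (0 < N)%N ->
  exists a b m, [/\ N = 2 ^ a * p ^ b * m, odd m & coprime p m]%N.
Proof.
move=> N_gt0; have [m1 co_m1 EN] := pfactor_coprime p_pr N_gt0.
have m1_gt0 : (0 < m1)%N by move: N_gt0; rewrite EN muln_gt0 => /andP[].
have [m co_m Em1] := pfactor_coprime (isT : prime 2) m1_gt0.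
exists (logn 2 m1), (logn p N), m; split.
- by rewrite {1}EN {1}Em1; ring.
- by rewrite -coprime2n.
by move: co_m1; rewrite Em1 coprimeMr => /andP[].
Qed.

Lemma value_form_of_value (z : int) : z != 0 -> value z ->
  value_form p (fun b : nat => b = 0%N \/ (2 * k + 1 <= b)%N) z.
Proof.
move=> z0 valz; have z_gt0 : (0 < `|z|)%N by rewrite absz_gt0.
have [a [b [m [Ez odd_m co_m]]]] := nat_factor_2p z_gt0.
have [w prim_w] := C_prim_root_exists (ltnW pk_gt1).
exists a, b, ((-1) ^+ (z < 0)%R * m%:Z); split.
- rewrite coprimezE abszMsign /= coprimeMr coprimen2 odd_m /=.
  by rewrite coprime_sym.
- case: a Ez => [|[|a]] Ez; [by left | | by right].
  have : (4 %| z)%Z.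
    apply: dihedral_value_even pk_gt1 _ valz _.
    by rewrite dvdzE Ez /= -mulnA dvdn_mulr.
  rewrite dvdzE Ez expn1 -mulnA (@dvdn_pmul2l 2 2) //.
  by rewrite dvdn2 oddM oddX odd_p odd_m orbT.
- case: b Ez => [|b] Ez; [by left | right].
  have co_p2 : coprime p 2 by rewrite coprimen2.
  have [f [g Enorm]] := dihedral_value_norm pk_gt1 prim_w valz.
  have p_z : (p %| z)%Z.
    by rewrite dvdzE Ez expnS mulnAC -mulnA dvdn_mull // dvdn_mull // dvdn_mulr.
  have := dihedral_value_p p_pr odd_p k_gt0 prim_w z0 Enorm p_z.
  rewrite dvdzE abszX /= Ez Gauss_dvdl ?Gauss_dvdr ?dvdn_Pexp2l ?prime_gt1 //.
    by rewrite coprimeXl // coprimeXr.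
  by rewrite coprimeXl.
rewrite [LHS]intEsign Ez !PoszM [RHS]mulrCA; congr (_ * (_ * _)).
by rewrite -[Posz (2 ^ a)]natz -[Posz (p ^ b)]natz !natrX !natz.
Qed.

Lemma value_of_form (B : nat -> Prop) (z : int) :
    (forall b, B b -> value (p ^ b)%N) -> value_form p B z -> value z.
Proof.
move=> valB [a [b [m [co_m a01 Bb ->]]]].
have [w prim_w] := C_prim_root_exists (ltnW pk_gt1).
have odd_pk : odd (p ^ k) by rewrite oddX odd_p orbT.
have val1 := value_coprime pk_gt1 prim_w odd_pk (isT : odd 1) (coprimen1 _).
apply: int_group_det_valueM; first apply: int_group_det_valueM.
- case: a01 => [-> // | a2]; rewrite -[2%:Z ^+ a]/((2%:Z) ^+ a).
  have := value_pow2 pk_gt1 prim_w odd_pk a2.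
  by rewrite -[Posz (2 ^ a)]natz natrX natz.
- by have := valB b Bb; rewrite -[Posz (p ^ b)]natz natrX natz.
have co_m2p : coprime `|m| (2 * p) by move: co_m; rewrite coprimezE.
have valm : value `|m|%N.
  move: co_m2p; rewrite coprimeMr => /andP[odd_m co_mp].
  apply: (value_coprime pk_gt1 prim_w odd_pk).
    by rewrite -coprimen2.
  by rewrite coprime_sym coprimeXr.
rewrite [m]intEsign; apply: int_group_det_valueM => //.
by case: (m < 0)%R; [apply: (value_opp1 pk_gt1 prim_w odd_pk) | apply: val1].
Qed.

End DihedralPrimePower.

Theorem theorem5p4 :
  (forall p : nat, p \in [:: 3; 5; 7]%N ->
     forall z : int,
       (z != 0 /\ int_group_det_value 'D_(2 * p ^ 2)%N z) <->
       value_form p (fun b : nat => b = 0%N \/ (5 <= b)%N) z) /\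
  (forall p k : nat, prime p -> odd p -> (2 <= k)%N ->
     [/\ forall z : int,
           z != 0 -> int_group_det_value 'D_(2 * p ^ k)%N z ->
           value_form p (fun b : nat => b = 0%N \/ (2 * k + 1 <= b)%N) z,
         forall z : int,
           value_form p (fun b : nat => b = 0%N \/ (3 * k <= b)%N) z ->
           int_group_det_value 'D_(2 * p ^ k)%N z &
         exists z : int,
           int_group_det_value 'D_(2 * p ^ k)%N z /\
           value_form p (fun b : nat => b = (2 * k + 1)%N) z]).
Proof.
split=> [p p357 z | p k p_pr odd_p k_gt1].
  have [p_pr odd_p val5] : [/\ prime p, odd p &
      int_group_det_value 'D_(2 * p ^ 2)%N (p ^ 5)%N].
    move: p357; rewrite !inE => /or3P[] /eqP->; split=> //.
    - exact: value_3_exponent5.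
    - exact: value_5_exponent5.
    exact: value_7_exponent5.
  split=> [[z0 valz] | form_z].
    exact: (@value_form_of_value p 2 p_pr odd_p isT z z0 valz).
  split; first exact: value_form_neq0 form_z.
  apply: (value_of_form p_pr odd_p _ _ form_z) => // b.
  have [w prim_w] : {w : algC | (p ^ 2)%N.-primitive_root w}.
    by apply: C_prim_root_exists; rewrite expn_gt0 prime_gt0.
  have odd_p2 : odd (p ^ 2) by rewrite oddX odd_p.
  have p2_gt1 : (1 < p ^ 2)%N by rewrite -(exp1n 2) ltn_exp2r // prime_gt1.
  case=> [-> | b5]; first exact: (value_coprime p2_gt1 prim_w odd_p2 _ (coprimen1 _)).
  have [->|b6] : b = 5 \/ (6 <= b)%N by lia.
    exact: val5.
  exact: (value_p_power p_pr odd_p _ prim_w).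
have k_gt0 := ltnW k_gt1.
have [w prim_w] : {w : algC | (p ^ k)%N.-primitive_root w}.
  by apply: C_prim_root_exists; rewrite expn_gt0 prime_gt0.
have odd_pk : odd (p ^ k) by rewrite oddX odd_p orbT.
have pk_gt1 : (1 < p ^ k)%N by rewrite -(exp1n k) ltn_exp2r // prime_gt1.
split=> [z | z form_z |]; first exact: value_form_of_value.
  apply: (value_of_form p_pr odd_p _ _ form_z) => // b [-> | b3k].
    exact: (value_coprime pk_gt1 prim_w odd_pk _ (coprimen1 _)).
  exact: (value_p_power p_pr odd_p k_gt0 prim_w).
have [z [valz dvd_z z_exact]] := value_exact p_pr odd_p k_gt0 prim_w.
have z0 : z != 0 by apply: contraNneq z_exact => ->.
have [a [b [m [co_m a01 _ Ez]]]] := value_form_of_value p_pr odd_p k_gt0 z0 valz.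
exists z; split=> //; exists a, b, m; split=> //.
have p_gt1 := prime_gt1 p_pr.
have co_p2 : coprime p 2 by rewrite coprimen2.
have co_pm : coprime p `|m|.
  move: co_m; rewrite coprimezE /= coprimeMr => /andP[_].
  by rewrite coprime_sym.
have dvd_pow c : (p%:Z ^+ c %| z)%Z = (c <= b)%N.
  rewrite Ez dvdzE !abszM !abszX /= Gauss_dvdl ?coprimeXl //.
  by rewrite Gauss_dvdr ?dvdn_Pexp2l // coprimeXl // coprimeXr.
move: z_exact dvd_z; rewrite !dvd_pow; lia.
Qed.
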